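(* Let $A$ be a Dedekind domain with quotient field $K$, let $L$ be a finite extension field of $K$, and let $B$ be the integral closure of $A$ in $L$. Then for every nonzero prime ideal $\mathfrak{p}$ of $A$ one has $$\sum_{\mathfrak{P}\mid\mathfrak{p}} e_{\mathfrak{P}} f_{\mathfrak{P}} = [(L\otimes_K K_{\mathfrak{p}}^* )_{\rm ss} : K_{\mathfrak{p}}^*],$$ where the sum is over the prime ideals $\mathfrak{P}$ of $B$ lying over $\mathfrak{p}$.
   Context: For a prime $\mathfrak{P}$ of the Dedekind domain $B$ over $\mathfrak{p}$, $e_{\mathfrak{P}}$ is the ramification index (the exponent of $\mathfrak{P}$ in the factorization of $\mathfrak{p}B$) and $f_{\mathfrak{P}}=[B/\mathfrak{P}:A/\mathfrak{p}]$ is the residue class degree. $K_{\mathfrak{p}}^*$ denotes the completion of $K$ with respect to the $\mathfrak{p}$-adic valuation. $(L\otimes_K K_{\mathfrak{p}}^* )_{\rm ss}$ denotes the semi-simplification of the finite-dimensional commutative $K_{\mathfrak{p}}^*$-algebra $L\otimes_K K_{\mathfrak{p}}^*$, i.e. its quotient by its Jacobson radical (equivalently, by its nilradical), and $[\,\cdot\,:K_{\mathfrak{p}}^*]$ denotes dimension over $K_{\mathfrak{p}}^*$. No finiteness of $B$ as an $A$-module is assumed. *)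

(* Defs.v *)
From HB Require Import structures.
From mathcomp Require Import all_boot all_order all_algebra all_field.
From mathcomp Require Import ring_quotient fraction.
From mathcomp Require Import boolp classical_sets functions cardinality fsbigop.

Set Implicit Arguments.
Unset Strict Implicit.
Unset Printing Implicit Defensive.

Import Order.TTheory GRing.Theory Num.Theory.
Local Open Scope classical_set_scope.
Local Open Scope ring_scope.
Local Open Scope quotient_scope.

Section PrimeIdeals.
Variable R : comNzRingType.

(* A small copy of [prime_idealr R], whose universe is too large for it to be *)
(* given equality and choice structures. Equality is extensional.             *)
Record prime_ideal := PrimeIdeal {
  prime_carrier :> R -> bool;
  prime_ideal_idealr : idealr_closed prime_carrier;
  prime_ideal_prime : prime_idealr_closed prime_carrier }.

HB.instance Definition _ (P : prime_ideal) :=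
  isIdealr.Build R (prime_carrier P) (prime_ideal_idealr P).
HB.instance Definition _ (P : prime_ideal) :=
  isPrimeIdealrClosed.Build R (prime_carrier P) (@prime_ideal_prime P).
HB.instance Definition _ := gen_eqMixin prime_ideal.
HB.instance Definition _ := gen_choiceMixin prime_ideal.

Canonical prime_ideal_predType := PredType prime_carrier.
Coercion prime_ideal_struct (P : prime_ideal) : prime_idealr R := prime_carrier P.

Lemma prime_ideal_ext (P Q : prime_ideal) : P =i Q -> P = Q.
Proof.
case: P Q => [P iP pP] [Q iQ pQ] PQ.
have eqPQ : P = Q by apply/funext => x; apply: PQ.
by subst Q; congr PrimeIdeal; apply: Prop_irrelevance.
Qed.

End PrimeIdeals.

Section Ideals.
Variable R : comNzRingType.

(* In MathComp an [idealr] is a proper ideal; possibly improper ideals (such  *)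
(* as empty products of ideals) are represented by their underlying sets.     *)
Definition ideal_gen (X : set R) : set R :=
  [set x | exists (n : nat) (c g : 'I_n -> R),
     (forall i, X (g i)) /\ x = \sum_(i < n) c i * g i].

Definition ideal_mul (I J : set R) : set R :=
  ideal_gen [set x * y | x in I & y in J].

Definition ideal_prod (s : seq (prime_ideal R)) : set R :=
  foldr (fun P I => ideal_mul [set x | x \in P] I) [set: R] s.

(* The exponent of P in the factorization of I into prime ideals; it is 0 by  *)
(* convention when I has no such factorization. In a Dedekind domain every    *)
(* nonzero I has exactly one, up to order.                                    *)
Definition ideal_exponent (P : prime_ideal R) (I : set R) : nat :=
  xget 0%N [set n | exists s, I = ideal_prod s /\ n = count_mem P s].

Definition maximal_ideal (m : idealr R) : Prop :=
  forall I : idealr R, {subset m <= I} -> {subset I <= m}.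

Definition jacobson_radical : pred R :=
  fun x => `[< forall m : idealr R, maximal_ideal m -> x \in m >].

Definition noetherian : Prop :=
  forall I : idealr R, exists s : seq R,
    [set x | x \in I] = ideal_gen [set x | x \in s].

Lemma maximal_ideal_exists : exists m : idealr R, maximal_ideal m.
Proof.
pose ispred (S : set R) := idealr_closed (fun x => `[< S x \/ x = 0 >]).
have [|S [HS Smax]] := @Zorn_bigcup R ispred.
  move=> F FP tot; split.
  - by apply/asboolP; right.
  - apply/asboolP => -[[X FX X1]|/eqP]; last by rewrite oner_eq0.
    by have [_ /asboolP H _] := FP _ FX; apply: H; left.
  - move=> a u v /asboolP Hu /asboolP Hv; apply/asboolP.
    have key X : F X -> (X u \/ u = 0) -> (X v \/ v = 0) ->
      (\bigcup_(X in F) X) (a * u + v) \/ a * u + v = 0.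
      move=> FX Xu Xv; have [_ _ H] := FP _ FX.
      have /asboolP[?|?] := H a u v (introT (asboolP _) Xu) (introT (asboolP _) Xv).
        by left; exists X.
      by right.
    case: Hu Hv => [[X FX Xu]|u0] [[Y FY Yv]|v0].
    + have [XY|YX] := tot _ _ FX FY.
        by apply: (key Y) => //; left => //; apply: XY.
      by apply: (key X) => //; left => //; apply: YX.
    + by apply: (key X) => //; [left|right].
    + by apply: (key Y) => //; [right|left].
    + by right; rewrite u0 v0 mulr0 addr0.
pose q : pred R := fun x => `[< S x \/ x = 0 >].
pose qI := isIdealr.Build R q HS.
pose m : idealr R := HB.pack q qI.
exists m => I mI x Ix; apply: contrapT => xm.
apply: (Smax [set y | y \in I]).
  split.
    by move=> y Sy /=; apply: mI; apply/asboolP; left.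
  by move=> /(_ x Ix) Sx; apply: xm; apply/asboolP; left.
split.
- by apply/asboolP; right.
- apply/asboolP => -[/=|/eqP]; last by rewrite oner_eq0.
  by rewrite idealr1.
- move=> a u v /asboolP Hu /asboolP Hv; apply/asboolP; left => /=.
  have aux w : (w \in I) \/ w = 0 -> w \in I by case=> [//|->]; apply: idealr0.
  by apply: rpredD; [apply: idealMr|]; apply: aux.
Qed.

Lemma jacobson_radical_idealr : idealr_closed jacobson_radical.
Proof.
split.
- by apply/asboolP => m _; apply: idealr0.
- apply/asboolP => H; have [m /H] := maximal_ideal_exists.
  by rewrite idealr1.
- move=> a u v /asboolP Hu /asboolP Hv; apply/asboolP => m Hm.
  by apply: rpredD; [apply: idealMr; apply: Hu|apply: Hv].
Qed.

HB.instance Definition _ := isIdealr.Build R jacobson_radical jacobson_radical_idealr.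

End Ideals.

(* Noetherian, integrally closed, of Krull dimension at most 1.               *)
Definition dedekind (A : idomainType) : Prop :=
  [/\ noetherian A,
      forall x : {fraction A},
        integralOver (@tofrac A) x -> exists a, x = tofrac a
    & forall P : prime_ideal A,
        (exists2 x, x \in P & x != 0) -> maximal_ideal P].

Section IntegralClosure.
Variables (A : idomainType) (L : fieldExtType {fraction A}).

Definition to_ext : A -> L := in_alg L \o @tofrac A.
HB.instance Definition _ := GRing.RMorphism.on to_ext.

Definition integral_pred : pred L := fun x => `[< integralOver to_ext x >].

Lemma integral_pred_subring : subring_closed integral_pred.
Proof.
split.
- by apply/asboolP; apply: integral1.
- by move=> x y /asboolP ? /asboolP ?; apply/asboolP; apply: integral_sub.
- by move=> x y /asboolP ? /asboolP ?; apply/asboolP; apply: integral_mul.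
Qed.

HB.instance Definition _ :=
  GRing.isSubringClosed.Build L integral_pred integral_pred_subring.

Record integral_closure := IntegralClosure
  { int_val : L; int_valP : int_val \in integral_pred }.

HB.instance Definition _ := [isSub for int_val].
HB.instance Definition _ := [Choice of integral_closure by <:].
HB.instance Definition _ := [SubChoice_isSubComNzRing of integral_closure by <:].

Lemma to_ext_integral a : to_ext a \in integral_pred.
Proof. by apply/asboolP; apply: integral_id. Qed.

Definition to_int (a : A) : integral_closure := IntegralClosure (to_ext_integral a).

Lemma to_int_zmod_morphism : zmod_morphism to_int.
Proof. by move=> a b; apply: val_inj; rewrite /= !rmorphB. Qed.
Lemma to_int_monoid_morphism : monoid_morphism to_int.
Proof. by split=> [|a b]; apply: val_inj; rewrite /= ?rmorph1 ?rmorphM. Qed.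
HB.instance Definition _ := GRing.isZmodMorphism.Build A integral_closure to_int
  to_int_zmod_morphism.
HB.instance Definition _ := GRing.isMonoidMorphism.Build A integral_closure to_int
  to_int_monoid_morphism.

End IntegralClosure.

(* [S : F] for S regarded as an F-vector space through the ring map phi.      *)
Definition has_degree (F S : comNzRingType) (phi : F -> S) (n : nat) : Prop :=
  exists b : 'I_n -> S, forall x : S,
    exists! c : {ffun 'I_n -> F}, x = \sum_(i < n) phi (c i) * b i.

Definition finite_degree (F S : comNzRingType) (phi : F -> S) : Prop :=
  exists n, has_degree phi n.

(* 0 by convention when the dimension is infinite.                            *)
Definition degree (F S : comNzRingType) (phi : F -> S) : nat :=
  xget 0%N (has_degree phi).

Section Primes.
Variables (A : idomainType) (L : fieldExtType {fraction A}).
Local Notation B := (integral_closure L).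
Variable p : prime_ideal A.

Definition primes_over : set (prime_ideal B) :=
  [set P : prime_ideal B | forall a, (to_int L a \in P) = (a \in p)].

Definition ramification_index (P : prime_ideal B) : nat :=
  ideal_exponent P (ideal_gen [set to_int L a | a in [set a | a \in p]]).

(* The map A/p -> B/P induced by A -> B; it does not depend on the            *)
(* representatives when P lies over p.                                        *)
Definition residue_map (P : prime_ideal B) : {ideal_quot p} -> {ideal_quot P} :=
  fun x => \pi_({ideal_quot P}) (to_int L (repr x)).

Definition residue_degree (P : prime_ideal B) : nat := degree (residue_map P).

(* v(a/b) = v(a) - v(b), with v(a) the exponent of p in the factorization     *)
(* of the ideal aA. The value at 0 is meaningless.                            *)
Definition padic_val (x : {fraction A}) : int :=
  (ideal_exponent p (ideal_gen [set \n_(repr x)]))%:Z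
  - (ideal_exponent p (ideal_gen [set \d_(repr x)]))%:Z.

End Primes.

Arguments primes_over {A} L p.
Arguments residue_map {A L} p P.

Section Completion.
Variables (K E : fieldType) (v : K -> int) (iota : {rmorphism K -> E}).

(* Discrete valuations are integer-valued functions whose value at 0 is       *)
(* meaningless, standing for +oo.                                             *)
Definition valuation_axiom (F : fieldType) (w : F -> int) : Prop :=
  (forall x y, x != 0 -> y != 0 -> w (x * y) = w x + w y) /\
  (forall x y, x != 0 -> y != 0 -> x + y != 0 ->
     Order.min (w x) (w y) <= w (x + y)).

Definition near_for (F : fieldType) (w : F -> int) (N : int) (x y : F) : Prop :=
  x = y \/ N <= w (x - y).

(* (E, w) is a complete valued field extending (K, v) in which K is dense.    *)
Definition is_completion (w : E -> int) : Prop :=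
  [/\ valuation_axiom w,
      forall x, x != 0 -> w (iota x) = v x,
      forall (x : E) (N : int), exists y : K, near_for w N x (iota y)
    & forall u : nat -> E,
        (forall N, exists m, forall i j, (m <= i)%N -> (m <= j)%N ->
           near_for w N (u i) (u j)) ->
        exists l, forall N, exists m, forall i, (m <= i)%N ->
           near_for w N (u i) l].

End Completion.

Section TensorProduct.
Variables (K : fieldType) (L : fieldExtType K) (E : fieldType).
Variable iota : {rmorphism K -> E}.

Definition balanced (V : zmodType) (g : L -> E -> V) : Prop :=
  [/\ forall x x' y, g (x + x') y = g x y + g x' y,
      forall x y y', g x (y + y') = g x y + g x y'
    & forall (a : K) x y, g (a *: x) y = g x (iota a * y)].

(* The E-algebra T, with t x y = "x (x) y", is the tensor product of L and E  *)
(* over K: it is the target of the universal balanced biadditive map, and     *)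
(* has the usual product and E-algebra structure.                             *)
Definition is_tensor_product (T : comAlgType E) (t : L -> E -> T) : Prop :=
  [/\ balanced t,
      forall (V : zmodType) (g : L -> E -> V), balanced g ->
        exists! h : {additive T -> V}, forall x y, h (t x y) = g x y,
      t 1 1 = 1,
      forall x x' y y', t (x * x') (y * y') = t x y * t x' y'
    & forall (a : E) x y, a *: t x y = t x (a * y)].

End TensorProduct.

Definition semisimplification (T : comNzRingType) : comNzRingType :=
  {ideal_quot (@jacobson_radical T : idealr T)}.

Definition ss_map (E : fieldType) (T : comAlgType E) : E -> semisimplification T :=
  fun a => \pi_({ideal_quot (@jacobson_radical T : idealr T)}) (a%:A).

(* Main.v *)
Require Import Defs.
From HB Require Import structures.
From mathcomp Require Import all_boot all_order all_algebra all_field.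
From mathcomp Require Import ring_quotient fraction.
From mathcomp Require Import boolp classical_sets functions cardinality fsbigop.

(** Both sides of the formula are the dimension of B/pB over the residue field
k = A/p. Write K for the fraction field of A, E for the completion of K, and
theta : L -> T for the map x |-> x (x) 1.

Ideals. A family in B that is independent over k modulo pB is independent over
K: a relation over K, scaled so that its coefficients are p-integral and not
all in p, reduces to a relation over k ([independent_bound]). So B/pB has
dimension at most [L : K]. Therefore every ideal above pB is finitely generated
([fin_gen_over]) and every prime above pB is maximal ([prime_over_maximal]);
moreover pB is invertible because p is, and B is integrally closed. These four
facts are what the classical argument for factorization into primes uses
([over_invertible], [factorization]), so it applies to the ideals above pB just
as it applies to the ideals of A. Write pB as the product of a list s of
primes. Multiplying an invertible ideal J by P lowers it by J/PJ, which is
isomorphic to B/P ([rel_dim_mul]), so the dimension of B/pB is the sum of f_P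
for P in s. Each P over p occurs e_P times in s, and this gives the left-hand
side ([sum_over]).

Completion. Let pi be a uniformizer, M the module spanned by theta(B) over the
valuation ring of E, and D the intersection of the pi^N M. An element x of L
with theta(x) in M lies in the localization of B at p ([purity]), so that
M/(pi M) is B/pB. Hence a k-basis of B/pB is an E-basis of T/D: independence
follows by scaling a relation ([completion_independent]), and generation by
successive approximation, which converges because E is complete
([completion_span_lat]).

Finally D is the Jacobson radical of T. The elements of M are integral over the
valuation ring. If some d in D were congruent to 1 modulo a maximal ideal, then
d/pi, which lies in M, would show that 1/pi is integral over the valuation ring
([divisible_jacobson]). Conversely T is algebraic over E, so its radical is
nil. A nilpotent x in M is, up to a small error, theta(b) with b in B; a power
of b is then divisible by a high power of pi, and so is b itself because B is
integrally closed. Thus x lies in D ([nilpotent_lat]). *)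

Set Implicit Arguments.
Unset Strict Implicit.
Unset Printing Implicit Defensive.

Import Order.TTheory GRing.Theory Num.Theory.
Local Open Scope classical_set_scope.
Local Open Scope ring_scope.
Local Open Scope quotient_scope.

(** * Ideals as sets, and invertible ideals *)

Section Ideals.
Variable R : comNzRingType.
Implicit Types (I J X Y : set R) (P Q : prime_ideal R) (s : seq (prime_ideal R)).

(** An [idealr] is proper; here the whole ring is an ideal too, so that
ideals are closed under products and quotients by invertible ideals. *)
Definition is_ideal I := I 0 /\ forall a x y, I x -> I y -> I (a * x + y).

Definition principal (c : R) : set R := [set c * x | x in [set: R]].

(** Invertibility without fractional ideals: some multiple of I is principal, with a
generator that can be cancelled. *)
Definition invertible I :=
  exists J c, [/\ is_ideal J, GRing.lreg c & ideal_mul I J = principal c].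

Definition carrier (D : {pred R}) : set R := [set x | x \in D].

Lemma is_idealD I x y : is_ideal I -> I x -> I y -> I (x + y).
Proof. by move=> [_ h] Ix Iy; rewrite -[x]mul1r; apply: h. Qed.

Lemma is_idealM I a x : is_ideal I -> I x -> I (a * x).
Proof. by move=> [h0 h] Ix; rewrite -[a * x]addr0; apply: h. Qed.

Lemma is_idealMr I a x : is_ideal I -> I x -> I (x * a).
Proof. by move=> h Ix; rewrite mulrC; apply: is_idealM. Qed.

Lemma is_idealB I x y : is_ideal I -> I x -> I y -> I (x - y).
Proof. by move=> h Ix Iy; rewrite addrC -mulN1r; case: h => _; apply. Qed.

Lemma is_ideal_sum I (T : Type) (r : seq T) (D : pred T) (F : T -> R) :
  is_ideal I -> (forall i, D i -> I (F i)) -> I (\sum_(i <- r | D i) F i).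
Proof.
move=> hI hF; elim/big_rec: _ => [|i x Di Ix]; first by case: hI.
by apply: is_idealD => //; apply: hF.
Qed.

Lemma is_idealT : is_ideal [set: R].
Proof. by []. Qed.

Lemma is_ideal1 I : is_ideal I -> I 1 -> I = [set: R].
Proof.
by move=> hI I1; apply/seteqP; split=> // x _; rewrite -[x]mulr1; apply: is_idealM.
Qed.

Lemma is_ideal_idealr (I : idealr R) : is_ideal (carrier I).
Proof.
split=> [|a x y]; rewrite /carrier /=; first exact: idealr0.
by move=> Ix Iy; apply: rpredD => //; apply: idealMr.
Qed.

Lemma is_ideal_prime P : is_ideal (carrier P).
Proof. exact: (is_ideal_idealr P). Qed.

Lemma prime_not1 P : ~ carrier P 1.
Proof. by rewrite /carrier /= (idealr1 (P : idealr R)). Qed.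

Lemma ideal_gen_ideal X : is_ideal (ideal_gen X).
Proof.
split; first by exists 0%N, (fun=> 0), (fun=> 0); split; [case|rewrite big_ord0].
move=> a _ _ [m [c [g [Xg ->]]]] [n [d [h [Xh ->]]]].
exists (m + n)%N.
exists (fun i : 'I_(m + n) => match fintype.split i with inl j => a * c j | inr j => d j end).
exists (fun i : 'I_(m + n) => match fintype.split i with inl j => g j | inr j => h j end).
split=> [i|]; first by case: (fintype.split i).
rewrite big_split_ord mulr_sumr /=; congr (_ + _); apply: eq_bigr => i _.
  case: (splitP (lshift n i)) => [j e|j e]; last by have := ltn_ord i; rewrite [X in (X < _)%N]e ltnNge leq_addr.
  by rewrite -mulrA; congr (_ * (c _ * g _)); apply: val_inj.
case: (splitP (rshift m i)) => [j e|j /eqP].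
  by have := ltn_ord j; rewrite -[X in (X < _)%N]e ltnNge leq_addr.
by rewrite /= eqn_add2l => /eqP e; congr (d _ * h _); apply: val_inj.
Qed.

Lemma ideal_gen_sub X : X `<=` ideal_gen X.
Proof.
move=> x Xx; exists 1%N, (fun=> 1), (fun=> x); split=> //.
by rewrite big_ord1 mul1r.
Qed.

Lemma ideal_gen_min X I : is_ideal I -> X `<=` I -> ideal_gen X `<=` I.
Proof.
move=> hI XI _ [n [c [g [Xg ->]]]]; apply: is_ideal_sum => // i _.
by apply: is_idealM => //; apply: XI.
Qed.

Lemma ideal_mul_ideal I J : is_ideal (ideal_mul I J).
Proof. exact: ideal_gen_ideal. Qed.

Lemma ideal_mul_in I J x y : I x -> J y -> ideal_mul I J (x * y).
Proof. by move=> Ix Jy; apply: ideal_gen_sub; exists x => //; exists y. Qed.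

Lemma ideal_mul_min I J X : is_ideal X ->
  (forall x y, I x -> J y -> X (x * y)) -> ideal_mul I J `<=` X.
Proof.
by move=> hX h; apply: ideal_gen_min => // _ [x Ix [y Jy <-]]; apply: h.
Qed.

Lemma ideal_mulS I I' J J' :
  I `<=` I' -> J `<=` J' -> ideal_mul I J `<=` ideal_mul I' J'.
Proof.
move=> sI sJ; apply: ideal_mul_min; first exact: ideal_mul_ideal.
by move=> x y Ix Jy; apply: ideal_mul_in; [apply: sI|apply: sJ].
Qed.

Lemma ideal_mulC I J : ideal_mul I J = ideal_mul J I.
Proof.
suff h X Y : ideal_mul X Y `<=` ideal_mul Y X by apply/seteqP; split; apply: h.
apply: ideal_mul_min; first exact: ideal_mul_ideal.
by move=> x y Xx Yy; rewrite mulrC; apply: ideal_mul_in.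
Qed.

Lemma is_ideal_transporter I z : is_ideal I -> is_ideal [set x | I (x * z)].
Proof.
move=> hI; split=> [|a x y] /=; first by rewrite mul0r; case: hI.
by move=> Ix Iy; rewrite mulrDl -mulrA; case: hI => _; apply.
Qed.

Lemma ideal_mulA I J X : ideal_mul I (ideal_mul J X) = ideal_mul (ideal_mul I J) X.
Proof.
suff h I1 J1 X1 : ideal_mul (ideal_mul I1 J1) X1 `<=` ideal_mul I1 (ideal_mul J1 X1).
  apply/seteqP; split; last exact: h.
  rewrite ideal_mulC (ideal_mulC J) (ideal_mulC _ X) (ideal_mulC I); exact: h.
apply: ideal_mul_min => [|x z]; first exact: ideal_mul_ideal.
move=> IJx Xz; pose Z := ideal_mul I1 (ideal_mul J1 X1).
have hZ : is_ideal [set x | Z (x * z)].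
  exact/is_ideal_transporter/ideal_mul_ideal.
apply: (ideal_mul_min hZ) IJx => u v Iu Jv /=.
by rewrite -mulrA; do 2!apply: ideal_mul_in => //.
Qed.

Lemma ideal_mul_subr I J : is_ideal J -> ideal_mul I J `<=` J.
Proof. by move=> hJ; apply: ideal_mul_min => // x y _; apply: is_idealM. Qed.

Lemma ideal_mul_subl I J : is_ideal I -> ideal_mul I J `<=` I.
Proof. by rewrite ideal_mulC; apply: ideal_mul_subr. Qed.

Lemma ideal_mulT I : is_ideal I -> ideal_mul I [set: R] = I.
Proof.
move=> hI; apply/seteqP; split; first exact: ideal_mul_subl.
by move=> x Ix; rewrite -[x]mulr1; apply: ideal_mul_in.
Qed.

Lemma principal_ideal c : is_ideal (principal c).
Proof.
split; first by exists 0; rewrite ?mulr0.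
move=> a _ _ [x _ <-] [y _ <-]; exists (a * x + y) => //.
by rewrite mulrDr mulrCA.
Qed.

Lemma principal_self c : principal c c.
Proof. by exists 1; rewrite ?mulr1. Qed.

Lemma ideal_gen1 c : ideal_gen [set c] = principal c.
Proof.
apply/seteqP; split.
  apply: ideal_gen_min; first exact: principal_ideal.
  by move=> _ ->; apply: principal_self.
by move=> _ [x _ <-]; apply: is_idealMr; [exact: ideal_gen_ideal|exact: ideal_gen_sub].
Qed.

Lemma principal_mul c I : is_ideal I -> ideal_mul (principal c) I = [set c * x | x in I].
Proof.
move=> hI; apply/seteqP; split; last first.
  by move=> _ [x Ix <-]; apply: ideal_mul_in => //; apply: principal_self.
apply: ideal_mul_min => [|_ y [x _ <-] Iy].
  split=> [|a _ _ [x Ix <-] [y Iy <-]]; first by exists 0; rewrite ?mulr0 //; case: hI.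
  by exists (a * x + y); [case: hI => _; apply|rewrite mulrDr mulrCA].
by exists (x * y); rewrite ?mulrA //; apply: is_idealM.
Qed.

Lemma principalM c d : ideal_mul (principal c) (principal d) = principal (c * d).
Proof.
rewrite principal_mul; last exact: principal_ideal.
apply/seteqP; split=> [_ [_ [x _ <-] <-]|_ [x _ <-]].
  by exists x; rewrite ?mulrA.
by exists (d * x); rewrite ?mulrA //; exists x.
Qed.

Lemma principal_invertible c : GRing.lreg c -> invertible (principal c).
Proof.
move=> creg; exists [set: R], c; split=> //.
by rewrite ideal_mulT //; apply: principal_ideal.
Qed.

Lemma invertible_mul I J : invertible I -> invertible J -> invertible (ideal_mul I J).
Proof.
move=> [I' [c [hI' cr eI]]] [J' [d [hJ' dr eJ]]].
exists (ideal_mul I' J'), (c * d); split; first exact: ideal_mul_ideal.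
  exact: lregM.
rewrite -principalM -eI -eJ !ideal_mulA; congr (ideal_mul _ _).
by rewrite -!ideal_mulA (ideal_mulC J).
Qed.

Lemma invertible_cancel I X Y : invertible I -> is_ideal X -> is_ideal Y ->
  ideal_mul I X `<=` ideal_mul I Y -> X `<=` Y.
Proof.
move=> [J [c [_ cr e]]] hX hY sub x Xx.
have: ideal_mul J (ideal_mul I X) (c * x).
  rewrite ideal_mulA (ideal_mulC J) e principal_mul //.
  by exists x.
have h : ideal_mul J (ideal_mul I X) `<=` ideal_mul J (ideal_mul I Y) by exact: ideal_mulS.
by move=> /h; rewrite ideal_mulA (ideal_mulC J) e principal_mul // => -[y Yy /cr <-].
Qed.

(** To contain is to divide: if P J is generated by c, then X is J I divided by c. *)
Lemma invertible_factor I (P : set R) : invertible P -> is_ideal I -> I `<=` P ->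
  exists2 X, is_ideal X & I = ideal_mul P X.
Proof.
move=> [J [c [hJ cr e]]] hI IP.
have eJI X : is_ideal X -> ideal_mul P (ideal_mul J X) = [set c * x | x in X].
  by move=> hX; rewrite ideal_mulA e principal_mul.
pose X := [set x | ideal_mul J I (c * x)].
have hX : is_ideal X.
  split=> [|a x y]; rewrite /X /=; first by rewrite mulr0; case: (ideal_mul_ideal J I).
  by move=> hx hy; rewrite mulrDr mulrCA; case: (ideal_mul_ideal J I) => _; apply.
exists X => //; apply/seteqP; split=> [i Ii|]; last first.
  apply: ideal_mul_min => // u x Pu; rewrite /X /= => hx.
  have: ideal_mul P (ideal_mul J I) (c * (u * x)).
    by rewrite mulrCA; apply: ideal_mul_in.
  by rewrite eJI // => -[y Iy /cr <-].
have: ideal_mul P (ideal_mul J I) (c * i) by rewrite eJI //; exists i.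
suff sub : ideal_mul P (ideal_mul J I) `<=` [set c * x | x in ideal_mul P X].
  by move=> /sub [y Iy /cr <-].
rewrite -(principal_mul c (ideal_mul_ideal P X)).
apply: ideal_mul_min => [|u y Pu JIy]; first exact: ideal_mul_ideal.
have: ideal_mul J P y by apply: ideal_mulS JIy.
rewrite ideal_mulC e => -[x _ cx]; rewrite -cx in JIy *; rewrite mulrCA.
by apply: ideal_mul_in; [apply: principal_self|apply: ideal_mul_in].
Qed.

End Ideals.

(** * Maximal ideals and products of primes *)

Section Maximal.
Variable R : comNzRingType.
Implicit Types (I J X Y : set R) (P Q : prime_ideal R) (s : seq (prime_ideal R)).

Lemma idealr_of_set I : is_ideal I -> ~ I 1 -> exists m : idealr R, carrier m = I.
Proof.
move=> hI I1; pose q : pred R := fun x => `[< I x >].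
have hq : idealr_closed q.
  split; first by apply/asboolP; case: hI.
    by apply/asboolP.
  by move=> a u v /asboolP Iu /asboolP Iv; apply/asboolP; case: hI => _; apply.
pose qI := isIdealr.Build R q hq.
pose m : idealr R := HB.pack q qI.
by exists m; apply/seteqP; split=> x; rewrite /carrier /= -topredE /= => /asboolP.
Qed.

(** This says that R/m is a field, and is how maximality is used throughout. *)
Lemma maximal_inverse (m : idealr R) x :
  maximal_ideal m -> x \notin m -> exists y, 1 - x * y \in m.
Proof.
move=> mmax xm; pose J : set R := [set z | exists y, z - x * y \in m].
have hJ : is_ideal J.
  split=> [|a u v [y hy] [z hz]]; first by exists 0; rewrite mulr0 subrr idealr0.
  exists (a * y + z); rewrite mulrDr mulrCA opprD addrACA -mulrBr.
  by apply: rpredD => //; apply: idealMr.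
apply: contrapT => J1; have [I eI] := idealr_of_set hJ J1.
have Ix u : J u -> u \in I by rewrite -eI.
have mI : {subset m <= I}.
  by move=> u um; apply: Ix; exists 0; rewrite mulr0 subr0.
move/negP: xm; apply; apply: (mmax I mI).
by apply: Ix; exists 1; rewrite mulr1 subrr idealr0.
Qed.

Lemma inverse_maximal (m : idealr R) :
  (forall x, x \notin m -> exists y, 1 - x * y \in m) -> maximal_ideal m.
Proof.
move=> h I mI x Ix; apply/negPn/negP => /h [y] /mI Ixy.
have: 1 \in I by rewrite -(subrK (x * y) 1) rpredD // mulrC idealMr.
by rewrite idealr1.
Qed.

Lemma maximal_prime (m : idealr R) : maximal_ideal m ->
  exists2 P : prime_ideal R, carrier P = carrier m & maximal_ideal P.
Proof.
move=> mmax.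
have hm : idealr_closed m.
  split; [exact: idealr0|by rewrite idealr1|move=> a u v mu mv].
  by apply: rpredD => //; apply: idealMr.
have pm : prime_idealr_closed m.
  move=> u v uv; case: (boolP (u \in m)) => //= um.
  have [y hy] := maximal_inverse mmax um.
  rewrite -(mul1r v) -(subrK (u * y) 1) mulrDl rpredD //.
    by rewrite mulrC idealMr.
  by rewrite mulrAC mulrC idealMr.
by exists (PrimeIdeal hm pm).
Qed.

End Maximal.

Section Products.
Variable R : comNzRingType.
Implicit Types (I J X Y : set R) (P Q : prime_ideal R) (s : seq (prime_ideal R)).

(** The existence of one maximal ideal, applied to R/I, gives one above I. *)
Lemma exists_maximal I : is_ideal I -> ~ I 1 ->
  exists2 P : prime_ideal R, maximal_ideal P & I `<=` carrier P.
Proof.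
move=> hI I1; have [i ei] := idealr_of_set hI I1.
have [n nmax] := maximal_ideal_exists {ideal_quot i}.
pose pi (x : R) : {ideal_quot i} := \pi_({ideal_quot i}) x.
have piB : {morph pi : x y / x - y} by move=> x y; rewrite /pi rmorphB.
have piM : {morph pi : x y / x * y} by move=> x y; rewrite /pi rmorphM.
have pi1 : pi 1 = 1 by rewrite /pi rmorph1.
have piE x : I x -> pi x = 0.
  rewrite -ei /carrier /= -[x]subr0 Quotient.idealrBE => /eqP e.
  by rewrite /pi subr0 e rmorph0.
pose J : set R := [set x | pi x \in n].
have hJ : is_ideal J.
  split=> [|a x y]; first by rewrite /J /= piE ?idealr0 //; case: hI.
  rewrite /J /= /pi => hx hy; rewrite rmorphD rmorphM.
  by apply: rpredD => //; apply: idealMr.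
have J1 : ~ J 1 by rewrite /J /= pi1 idealr1.
have [m em] := idealr_of_set hJ J1.
have mE x : (x \in m) = (pi x \in n).
  by apply/idP/idP => hx; [have : J x by rewrite -em|have : carrier m x by rewrite em].
have mmax : maximal_ideal m.
  apply: inverse_maximal => x; rewrite mE => /(maximal_inverse nmax)[y].
  by rewrite -[y]reprK => hy; exists (repr y); rewrite mE piB piM pi1.
have [P eP Pmax] := maximal_prime mmax.
exists P => // x Ix; rewrite eP /carrier /= mE piE //; exact: idealr0.
Qed.

Lemma pi_eq0 (I : idealr R) (x : R) :
  (\pi_({ideal_quot I}) x == 0) = (x \in I).
Proof. by rewrite -[x in RHS]subr0 Quotient.idealrBE -[0 in LHS](rmorph0 \pi_({ideal_quot I})). Qed.

Lemma maximal_eq P Q : maximal_ideal P -> carrier P `<=` carrier Q -> P = Q.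
Proof.
move=> Pmax PQ; apply: prime_ideal_ext => x; apply/idP/idP; first exact: PQ.
by apply: (Pmax (Q : idealr R)) => y; apply: PQ.
Qed.

Lemma prime_mul P I J : ideal_mul I J `<=` carrier P ->
  I `<=` carrier P \/ J `<=` carrier P.
Proof.
move=> sub; apply: contrapT => /not_orP[nI nJ].
have [x Ix Px] : exists2 x, I x & x \notin P.
  by apply: contrapT => h; apply: nI => x Ix; apply: contrapT => /negP Px; apply: h; exists x.
have [y Jy Py] : exists2 x, J x & x \notin P.
  by apply: contrapT => h; apply: nJ => y Jy; apply: contrapT => /negP Py; apply: h; exists y.
have := sub _ (ideal_mul_in Ix Jy); rewrite /carrier /=.
by have /= -> := prime_idealrM P x y; rewrite (negPf Px) (negPf Py).
Qed.

Lemma ideal_prod_ideal s : is_ideal (ideal_prod s).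
Proof. by case: s => [|P s]; [apply: is_idealT|apply: ideal_mul_ideal]. Qed.

Lemma ideal_prod_cons P s : ideal_prod (P :: s) = ideal_mul (carrier P) (ideal_prod s).
Proof. by []. Qed.

Lemma ideal_prod_cat s1 s2 :
  ideal_prod (s1 ++ s2) = ideal_mul (ideal_prod s1) (ideal_prod s2).
Proof.
elim: s1 => [|P s1 IH]; last by rewrite cat_cons !ideal_prod_cons IH ideal_mulA.
by rewrite ideal_mulC ideal_mulT //; apply: ideal_prod_ideal.
Qed.

Lemma ideal_prod_rem P s : P \in s ->
  ideal_prod s = ideal_mul (carrier P) (ideal_prod (rem P s)).
Proof.
elim: s => //= Q s IH; rewrite inE; case: eqP => [-> _|neq]; first by rewrite eqxx.
rewrite eq_sym => /= Ps; rewrite eq_sym; case: eqP => [e|_]; first by case: neq.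
by rewrite !ideal_prod_cons -/(carrier Q) IH // !ideal_mulA (ideal_mulC (carrier Q)).
Qed.

Lemma ideal_prod_sub P s : P \in s -> ideal_prod s `<=` carrier P.
Proof.
by move=> /ideal_prod_rem->; apply: ideal_mul_subl; apply: is_ideal_prime.
Qed.

Lemma prime_prod P s : ideal_prod s `<=` carrier P ->
  exists2 Q, Q \in s & carrier Q `<=` carrier P.
Proof.
elim: s => [h|Q s IH]; first by case: (@prime_not1 _ P); apply: h.
move=> /prime_mul[QP|/IH[Q' Q's sub]]; first by exists Q; rewrite ?inE ?eqxx.
by exists Q' => //; rewrite inE Q's orbT.
Qed.

(** Maximality turns the inclusion of a factor of the product in P into an equality. *)
Lemma prime_prod_maximal P s : {in s, forall Q, maximal_ideal Q} ->
  ideal_prod s `<=` carrier P -> P \in s.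
Proof.
by move=> hs /prime_prod[Q Qs /(maximal_eq (hs Q Qs))<-].
Qed.

(** Uniqueness of factorization: the first prime of s1 contains the product of s2,
so it occurs in s2; it is invertible, so it can be cancelled. *)
Lemma ideal_prod_inj s1 s2 :
  {in s1, forall P, maximal_ideal P /\ invertible (carrier P)} ->
  {in s2, forall P, maximal_ideal P} ->
  ideal_prod s1 = ideal_prod s2 -> perm_eq s1 s2.
Proof.
elim: s1 s2 => [|P s1 IH] s2 h1 h2 e.
  case: s2 h2 e => // Q s2 h2 e; case: (@prime_not1 _ Q).
  have /(_ 1) : ideal_prod (Q :: s2) `<=` carrier Q by apply: ideal_prod_sub; rewrite inE eqxx.
  by apply; rewrite -e.
have [Pmax Pinv] : maximal_ideal P /\ invertible (carrier P) by apply: h1; rewrite inE eqxx.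
have Ps2 : P \in s2.
  apply: (prime_prod_maximal h2); rewrite -e.
  by apply: ideal_prod_sub; rewrite inE eqxx.
rewrite perm_sym (permPl (perm_to_rem Ps2)) perm_cons perm_sym; apply: IH.
- by move=> Q Qs; apply: h1; rewrite inE Qs orbT.
- by move=> Q /mem_rem; apply: h2.
move: e; rewrite (ideal_prod_rem Ps2) ideal_prod_cons => e.
by apply/seteqP; split; apply: (invertible_cancel Pinv); rewrite ?e //; apply: ideal_prod_ideal.
Qed.

End Products.

(** * Factorization of the ideals above a fixed invertible ideal *)

Section Factorization.
Variable R : comNzRingType.
Implicit Types (I J X Y : set R) (P Q : prime_ideal R) (s : seq (prime_ideal R)).

Definition fin_gen J := exists s : seq R, J = ideal_gen [set x | x \in s].

(** Zorn on the ideals above a bad one: the union of a chain is finitely generated,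
hence equal to a member of the chain, hence bad, so a maximal bad ideal exists. *)
Lemma noetherian_induction I0 (Good : set R -> Prop) :
  (forall J, is_ideal J -> I0 `<=` J -> fin_gen J) ->
  (forall J, is_ideal J -> I0 `<=` J ->
     (forall J', is_ideal J' -> J `<=` J' -> ~ J' `<=` J -> Good J') -> Good J) ->
  forall J, is_ideal J -> I0 `<=` J -> Good J.
Proof.
move=> hfg ind J0 hJ0 I0J0; apply: contrapT => bad0.
pose bad (S : set R) := is_ideal (S `|` J0) /\ ~ Good (S `|` J0).
have [F Fbad tot|A [[hA badA] Amax]] := @Zorn_bigcup R bad.
  have [[X0 FX0]|F0] := pselect (exists X, F X); last first.
    rewrite /bad bigcup0 ?set0U // => X FX; by case: F0; exists X.
  set U := \bigcup_(X in F) X.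
  have inU X : F X -> X `|` J0 `<=` U `|` J0.
    by move=> FX x [Xx|]; [left; exists X|right].
  have pick (u : R) : (U `|` J0) u -> exists2 X, F X & (X `|` J0) u.
    by move=> [[X FX Xu]|J0u]; [exists X => //; left|exists X0 => //; right].
  have pick2 X Y : F X -> F Y -> exists2 Z, F Z & X `|` J0 `<=` Z `|` J0 /\ Y `|` J0 `<=` Z `|` J0.
    move=> FX FY; have [XY|YX] := tot _ _ FX FY.
      by exists Y => //; split=> //; apply: setSU.
    by exists X => //; split=> //; apply: setSU.
  have hU : is_ideal (U `|` J0).
    split=> [|a u v /pick[X FX Xu] /pick[Y FY Yv]]; first by right; case: hJ0.
    have [Z FZ [XZ YZ]] := pick2 _ _ FX FY; apply: (inU Z) => //.
    by have [[_ h] _] := Fbad _ FZ; apply: h; [apply: XZ|apply: YZ].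
  have [|s es] := hfg _ hU; first by move=> x /I0J0; right.
  have [X FX sX] : exists2 X, F X & forall x, x \in s -> (X `|` J0) x.
    have: forall x, x \in s -> (U `|` J0) x by move=> x xs; rewrite es; apply: ideal_gen_sub.
    elim: s {es} => [|y s IH] hs; first by exists X0.
    have [|X FX sX] := IH; first by move=> x xs; apply: hs; rewrite inE xs orbT.
    have [|Y FY Yy] := pick y; first by apply: hs; rewrite inE eqxx.
    have [Z FZ [XZ YZ]] := pick2 _ _ FX FY; exists Z => // x.
    by rewrite inE => /predU1P[->|/sX/XZ//]; apply: YZ.
  have [hX nGX] := Fbad _ FX.
  have eX : U `|` J0 = X `|` J0.
    apply/seteqP; split; last exact: inU.
    by rewrite es; apply: ideal_gen_min.
  by split; rewrite eX.
apply: badA; apply: ind => //; first by move=> x /I0J0; right.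
move=> J hJ sub nsub; apply: contrapT => bJ; apply: (Amax J); last first.
  by rewrite /bad setUidl // => x J0x; apply: sub; right.
by split=> [x Ax|JA]; [apply: sub; left|apply: nsub => x /JA; left].
Qed.

(** The setting serves twice: I0 is a nonzero principal ideal of A, to factor the
ideals of A, and then I0 is pB, to factor the ideals of B above pB. The last
hypothesis is integral closure without fractions: if y/c maps J to itself then
y/c is in the ring. *)
Variable I0 : set R.
Hypothesis I0ideal : is_ideal I0.
Hypothesis I0inv : invertible I0.
Hypothesis I0fg : forall J, is_ideal J -> I0 `<=` J -> fin_gen J.
Hypothesis I0max : forall P, I0 `<=` carrier P -> maximal_ideal P.
Hypothesis closed : forall J, is_ideal J -> fin_gen J -> I0 `<=` J ->
  forall c y, GRing.lreg c ->
  (forall x, J x -> exists2 z, J z & y * x = c * z) -> principal c y.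

Definition over s := {in s, forall P, I0 `<=` carrier P}.

(** Noetherian induction: if x y is in J and neither x nor y is, then J contains the
product of the larger ideals J + (x) and J + (y). *)
Lemma contains_prime_product J : is_ideal J -> I0 `<=` J ->
  exists2 s, over s & ideal_prod s `<=` J.
Proof.
move: J; apply: (noetherian_induction
  (Good := fun J => exists2 s, over s & ideal_prod s `<=` J) I0fg) => J hJ I0J IH.
have [J1|J1] := pselect (J 1).
  by exists [::] => //; rewrite (is_ideal1 hJ J1).
have [[x [y [xy nx ny]]]|prm] :=
  pselect (exists x y, [/\ J (x * y), ~ J x & ~ J y]).
  pose ext (z : R) : set R := [set w | exists a, J (w - a * z)].
  have ext_ideal z : is_ideal (ext z).
    split=> [|a u v [b hb] [c hc]]; first by exists 0; rewrite mul0r subr0; case: hJ.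
    exists (a * b + c); rewrite mulrDl opprD addrACA -mulrA -mulrBr.
    by case: hJ => _; apply.
  have extJ z : J `<=` ext z by move=> u Ju; exists 0; rewrite mul0r subr0.
  have extz z : ext z z by exists 1; rewrite mul1r subrr; case: hJ.
  have [|s1 o1 h1] := IH (ext x) (ext_ideal x) (extJ x); first by move=> /(_ x); auto.
  have [|s2 o2 h2] := IH (ext y) (ext_ideal y) (extJ y); first by move=> /(_ y); auto.
  exists (s1 ++ s2).
    by move=> P; rewrite mem_cat => /orP[/o1|/o2].
  rewrite ideal_prod_cat; apply: ideal_mul_min => // u v /h1[a hu] /h2[b hv].
  rewrite -(subrK (a * x) u) mulrDl; apply: is_idealD => //.
    exact: is_idealMr.
  rewrite -(subrK (b * y) v) mulrDr; apply: is_idealD => //.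
    exact: is_idealM.
  by rewrite mulrACA; apply: is_idealM.
have [m em] := idealr_of_set hJ J1.
have mJ x : (x \in m) -> J x by rewrite -em.
have Jm x : J x -> (x \in m) by rewrite -em.
have hm : idealr_closed m.
  split; [exact: idealr0|by rewrite idealr1|move=> a u v mu mv].
  by apply: rpredD => //; apply: idealMr.
have pm : prime_idealr_closed m.
  move=> u v /mJ uv; apply/orP; apply: contrapT => /not_orP[mu mv].
  by apply: prm; exists u, v; split=> // /Jm.
exists [:: PrimeIdeal hm pm]; first by move=> P; rewrite inE => /eqP-> x /I0J/Jm.
by rewrite ideal_prod_cons ideal_mulT; [move=> x /mJ|apply: is_ideal_prime].
Qed.

(** The classical argument: take a shortest product of primes inside I0, one of
which is P, and an element b of the product of the others that is not in I0.
Then b P is inside I0, so the fractional ideal b I0^-1 maps P into the ring, but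
it is not inside the ring. An element y/c of it outside the ring cannot map P to
itself, by integral closure, hence P (1, y/c) is the whole ring. *)
Lemma over_invertible P : I0 `<=` carrier P -> invertible (carrier P).
Proof.
move=> I0P.
have [s os [sI0 smin]] : exists2 s, over s & ideal_prod s `<=` I0 /\
    forall s', over s' -> (size s' < size s)%N -> ~ ideal_prod s' `<=` I0.
  have [s0 os0 h0] := contains_prime_product I0ideal (@subset_refl _ I0).
  have [n] := ubnP (size s0); elim: n s0 os0 h0 => // n IH s0 os0 h0 sz.
  have [[s' [o' z' h']]|no] := pselect (exists s', [/\ over s', (size s' < size s0)%N & ideal_prod s' `<=` I0]).
    by apply: (IH s') => //; apply: leq_trans z' _.
  by exists s0 => //; split=> // s' o' z' h'; apply: no; exists s'.
have Ps : P \in s.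
  apply: prime_prod_maximal (subset_trans sI0 I0P) => Q Qs.
  exact/I0max/os.
have [b bs nb] : exists2 b, ideal_prod (rem P s) b & ~ I0 b.
  apply: contrapT => h; apply: (smin (rem P s)).
  - by move=> Q /mem_rem; apply: os.
  - by rewrite size_rem // prednK //; case: (s) Ps.
  by move=> x hx; apply: contrapT => nx; apply: h; exists x.
have bP x : x \in P -> I0 (b * x).
  move=> Px; apply: sI0; rewrite (ideal_prod_rem Ps) mulrC.
  exact: ideal_mul_in.
have [J0 [c [hJ0 creg e]]] := I0inv.
(* J0/c is the inverse of I0; the element y/c with y := b * j lies in b I0^-1. *)
have [j Jj nj] : exists2 j, J0 j & ~ principal c (b * j).
  apply: contrapT => h; apply: nb.
  have: ideal_mul (principal c) I0 (c * b).
    rewrite -e; have /(_ c) : ideal_mul I0 J0 `<=` [set z | ideal_mul (ideal_mul I0 J0) I0 (z * b)].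
      apply: ideal_mul_min; first exact/is_ideal_transporter/ideal_mul_ideal.
      move=> x y I0x J0y /=; rewrite -mulrA mulrC; apply: ideal_mul_in => //.
      rewrite e mulrC; apply: contrapT => hy; apply: h; by exists y.
    by apply; rewrite e; apply: principal_self.
  by rewrite principal_mul // => -[x I0x /creg <-].
pose y := b * j.
have yP x : x \in P -> principal c (y * x).
  by move=> Px; rewrite -e /y mulrAC; apply: ideal_mul_in => //; apply: bP.
have [x [z [Px Pz yx]]] : exists x z, [/\ x \in P, z \notin P & y * x = c * z].
  apply: contrapT => h; apply: nj; apply: (closed (is_ideal_prime P)) => //.
    by apply: I0fg => //; apply: is_ideal_prime.
  move=> x Px; have [z _ ez] := yP x Px; exists z => //.
  by apply: contrapT => /negP Pz; apply: h; exists x, z.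
have [u hu] := maximal_inverse (I0max I0P) Pz.
(* The inverse of P is (c, y)/c: indeed z := y x / c is invertible modulo P. *)
exists (ideal_gen [set c; y]), c; split=> //; first exact: ideal_gen_ideal.
have hg := ideal_gen_ideal [set c; y].
apply/seteqP; split.
  apply: ideal_mul_min; first exact: principal_ideal.
  move=> v w Pv; rewrite mulrC.
  suff sub : ideal_gen [set c; y] `<=` [set w | principal c (w * v)] by apply: sub.
  apply: ideal_gen_min; first exact/is_ideal_transporter/principal_ideal.
  move=> _ [->|->] /=; last exact: yP.
  by apply: is_idealMr; [apply: principal_ideal|apply: principal_self].
have hPg := ideal_mul_ideal (carrier P) (ideal_gen [set c; y]).
move=> _ [v _ <-]; apply: is_idealMr => //.
have ec : c = (1 - z * u) * c + u * (x * y).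
  by rewrite (mulrC x) yx mulrBl mul1r mulrCA (mulrC z) mulrA (mulrC c) mulrAC -mulrA subrK.
rewrite [X in ideal_mul _ _ X]ec; apply: is_idealD => //.
  by apply: ideal_mul_in => //; apply: ideal_gen_sub; left.
apply: is_idealM => //; apply: ideal_mul_in => //.
by apply: ideal_gen_sub; right.
Qed.

(** J contains a product of primes. A maximal ideal P above J is one of them, so it
is invertible and can be divided out of both; the product gets shorter. *)
Lemma factorization J : is_ideal J -> I0 `<=` J -> exists2 s, over s & J = ideal_prod s.
Proof.
move=> hJ I0J; have [s os sJ] := contains_prime_product hJ I0J.
have [n] := ubnP (size s); elim: n s J hJ os sJ {I0J} => // n IH s J hJ os sJ sz.
have [J1|J1] := pselect (J 1); first by exists [::] => //; apply: is_ideal1.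
have [P Pmax JP] := exists_maximal hJ J1.
have Ps : P \in s.
  by apply: prime_prod_maximal (subset_trans sJ JP) => Q /os; apply: I0max.
have Pinv := over_invertible (os _ Ps).
have [X hX eJ] := invertible_factor Pinv hJ JP.
have [|||s' os' eX] := IH (rem P s) X hX.
- by move=> Q /mem_rem; apply: os.
- apply: (invertible_cancel Pinv) => //; first exact: ideal_prod_ideal.
  by rewrite -eJ -ideal_prod_rem.
- by rewrite size_rem //; case: (s) Ps sz.
exists (P :: s'); last by rewrite ideal_prod_cons -eX.
by move=> Q; rewrite inE => /predU1P[->|/os'//]; apply: os.
Qed.

(** By uniqueness of factorization the arbitrary choice in [ideal_exponent] is
harmless. *)
Lemma ideal_exponentE P s : I0 `<=` ideal_prod s -> ideal_exponent P (ideal_prod s) = count_mem P s.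
Proof.
move=> I0s; rewrite /ideal_exponent; case: xgetP => [n _ [s' [e ->]]|/(_ (count_mem P s))].
  have o2 s2 : ideal_prod s2 = ideal_prod s -> over s2.
    by move=> e2 Q Qs x /I0s; rewrite -e2; apply: ideal_prod_sub.
  suff /permP-> : perm_eq s s' by [].
  have [os os'] : over s /\ over s' by split; apply: o2.
  apply: ideal_prod_inj e => Q Qs; last exact/I0max/os'.
  by split; [apply/I0max/os|apply/over_invertible/os].
by case; exists s.
Qed.

End Factorization.

(** * The p-adic valuation of a Dedekind domain *)

Section StableIntegral.
Variables (R : comNzRingType) (F : fieldType) (phi : {rmorphism R -> F}).

Lemma ideal_gen_seq (s : seq R) x : ideal_gen [set y | y \in s] x ->
  exists c : 'I_(size s) -> R, x = \sum_i c i * s`_i.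
Proof.
pose I : set R := [set x | exists c : 'I_(size s) -> R, x = \sum_i c i * s`_i].
have hI : is_ideal I.
  split=> [|a u v [c ->] [d ->]].
    by exists (fun=> 0); rewrite big1 // => i _; rewrite mul0r.
  exists (fun i => a * c i + d i); rewrite mulr_sumr -big_split /=.
  by apply: eq_bigr => i _; rewrite mulrDl mulrA.
apply: (@ideal_gen_min _ _ I) => // y ys.
have ilt : (index y s < size s)%N by rewrite index_mem.
exists (fun i => (i == Ordinal ilt)%:R).
rewrite (bigD1 (Ordinal ilt)) //= eqxx mul1r nth_index // big1 ?addr0 // => i /negPf->.
by rewrite mul0r.
Qed.

(** The determinant trick: y/c acts on the generators of J through a matrix over R,
of which it is an eigenvalue. *)
Lemma stable_integral (J : set R) (c y : R) : fin_gen J ->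
  (exists2 x, J x & phi x != 0) -> phi c != 0 ->
  (forall x, J x -> exists2 z, J z & y * x = c * z) ->
  integralOver phi (phi y / phi c).
Proof.
move=> [s es] [x0 Jx0 x0n] cn h.
have /choice[u hu] : forall i : 'I_(size s), exists u : 'I_(size s) -> R, y * s`_i = c * \sum_j u j * s`_j.
  move=> i; have [|z Jz ->] := h s`_i.
    by rewrite es; apply: ideal_gen_sub; apply: mem_nth.
  by rewrite es in Jz; have [d ->] := ideal_gen_seq Jz; exists d.
pose U := \matrix_(i, j) u j i; pose v : 'rV[F]_(size s) := \row_i phi s`_i.
exists (char_poly U); first exact: char_poly_monic.
rewrite map_char_poly -eigenvalue_root_char; apply/eigenvalueP; exists v; last first.
  apply: contra_neq x0n => v0; rewrite es in Jx0; have [d ->] := ideal_gen_seq Jx0.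
  rewrite rmorph_sum big1 // => i _; rewrite rmorphM.
  by have := congr1 (fun w : 'rV_ _ => w 0 i) v0; rewrite !mxE => ->; rewrite mulr0.
apply/rowP => i; rewrite !mxE; apply: (mulfI cn).
rewrite mulrA mulrCA mulfV // mulr1 -!rmorphM hu rmorphM rmorph_sum; congr (_ * _).
by apply: eq_bigr => j _; rewrite !mxE mulrC rmorphM.
Qed.

End StableIntegral.

Section DedekindValuation.
Variables (A : idomainType) (hA : dedekind A) (p : prime_ideal A).
Hypothesis hp : exists2 x, x \in p & x != 0.
Implicit Types (a b n d u : A) (s : seq (prime_ideal A)).

Lemma dedekind_fin_gen (J : set A) : is_ideal J -> fin_gen J.
Proof.
move=> hJ; have [J1|J1] := pselect (J 1); last first.
  have [m <-] := idealr_of_set hJ J1; have [noeth _ _] := hA; exact: noeth.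
exists [:: 1]; rewrite (is_ideal1 hJ J1); apply/seteqP; split=> // x _.
rewrite -[x]mulr1; apply: is_idealM; first exact: ideal_gen_ideal.
by apply: ideal_gen_sub; rewrite /= inE.
Qed.

Lemma dedekind_closed a (J : set A) : a != 0 -> is_ideal J -> principal a `<=` J ->
  forall c y, GRing.lreg c ->
  (forall x, J x -> exists2 z, J z & y * x = c * z) -> principal c y.
Proof.
move=> an hJ aJ c y creg h; have [_ intcl _] := hA.
have cn : c != 0 by exact: lreg_neq0.
have [|z ez] := intcl (tofrac y / tofrac c).
  apply: (@stable_integral _ _ (@tofrac A) J) h => //.
  - exact: dedekind_fin_gen.
  - by exists a; rewrite ?tofrac_eq0 //; apply: aJ; apply: principal_self.
  - by rewrite tofrac_eq0.
exists z => //; apply/eqP; rewrite -tofrac_eq tofracM -ez mulrCA mulfV ?mulr1 //.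
by rewrite tofrac_eq0.
Qed.

Lemma dedekind_maximal a (P : prime_ideal A) : a != 0 -> principal a `<=` carrier P -> maximal_ideal P.
Proof.
move=> an aP; have [_ _] := hA; apply; exists a => //.
exact/aP/principal_self.
Qed.

Lemma dedekind_invertible a (P : prime_ideal A) : a != 0 -> a \in P -> invertible (carrier P).
Proof.
move=> an aP; apply: (@over_invertible _ (principal a)).
- exact: principal_ideal.
- by apply: principal_invertible; apply: mulfI.
- by move=> J hJ _; apply: dedekind_fin_gen.
- by move=> Q; apply: dedekind_maximal.
- by move=> J hJ _; apply: dedekind_closed.
- by move=> _ [x _ <-]; rewrite /carrier /= mulrC (idealMr (idealrI := P)).
Qed.

Lemma dedekind_factorization a : a != 0 -> exists s,
  [/\ principal a = ideal_prod s, forall P : prime_ideal A, P \in s -> maximal_ideal P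
    & forall P : prime_ideal A, ideal_exponent P (principal a) = count_mem P s].
Proof.
move=> an; have inv := principal_invertible (mulfI an).
have hI := principal_ideal a.
have hfg (J : set A) (hJ : is_ideal J) (_ : principal a `<=` J) := dedekind_fin_gen hJ.
have hmax (Q : prime_ideal A) := @dedekind_maximal a Q an.
have hcl (J : set A) (hJ : is_ideal J) (_ : fin_gen J) := dedekind_closed an hJ.
have [s os es] := factorization hI inv hfg hmax hcl hI (@subset_refl _ _).
exists s; split=> // [P /os|P]; first exact: dedekind_maximal.
by rewrite es; apply: (ideal_exponentE hI inv hfg hmax hcl); rewrite es.
Qed.

Local Notation ex a := (ideal_exponent p (principal a)).

Lemma ideal_prod_sort s : ideal_prod s =
  ideal_mul (ideal_prod (nseq (count_mem p s) p)) (ideal_prod (filter (predC1 p) s)).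
Proof.
elim: s => [|P s IH] /=; first by rewrite ideal_mulT.
rewrite -!/(carrier _) IH; case: eqP => [->|_] /=; first by rewrite ideal_mulA.
by rewrite !ideal_mulA (ideal_mulC (carrier P)).
Qed.

Lemma exponentM a b : a != 0 -> b != 0 -> ex (a * b) = (ex a + ex b)%N.
Proof.
move=> an bn; have [s [es os ->]] := dedekind_factorization an.
have [s' [es' os' ->]] := dedekind_factorization bn.
have abn : a * b != 0 by rewrite mulf_neq0.
have [t [et ot ->]] := dedekind_factorization abn.
suff /permP-> : perm_eq t (s ++ s') by rewrite count_cat.
rewrite perm_sym; apply: ideal_prod_inj => // [P Ps|]; last first.
  by rewrite -et -principalM es es' ideal_prod_cat.
have aP : a * b \in P.
  have sub : ideal_prod (s ++ s') `<=` carrier P by apply: ideal_prod_sub.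
  by apply: sub; rewrite ideal_prod_cat -es -es' principalM; apply: principal_self.
split; last exact: dedekind_invertible aP.
by move: Ps; rewrite mem_cat => /orP[/os|/os'].
Qed.

Lemma exponent_notin a : a \notin p -> ex a = 0%N.
Proof.
move=> ap; have an : a != 0 by apply: contraNneq ap => ->; exact: (idealr0 (p : idealr A)).
have [s [es os ->]] := dedekind_factorization an.
apply/count_memPn; apply: contra ap => ps.
have sub : ideal_prod s `<=` carrier p by apply: ideal_prod_sub.
by apply: sub; rewrite -es; apply: principal_self.
Qed.

Lemma principal_sub (I : set A) a : is_ideal I -> I a -> principal a `<=` I.
Proof. by move=> hI Ia _ [x _ <-]; apply: is_idealMr. Qed.

Lemma exponent_in a : a != 0 -> a \in p -> (0 < ex a)%N.
Proof.
move=> an ap; have [s [es os ->]] := dedekind_factorization an.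
rewrite -has_count has_pred1; apply: prime_prod_maximal os _.
by rewrite -es; apply: principal_sub => //; apply: is_ideal_prime.
Qed.

Lemma prime_invertible : invertible (carrier p).
Proof. by have [a ap an] := hp; apply: dedekind_invertible ap. Qed.

(** An element of p outside p^2, which differs from p because p is invertible. *)
Lemma uniformizer : exists2 a, a \in p & a != 0 /\ ex a = 1%N.
Proof.
pose p2 := ideal_mul (carrier p) (carrier p).
have [a ap np2] : exists2 a, a \in p & ~ p2 a.
  apply: contrapT => h; apply: (@prime_not1 _ p).
  suff sub : [set: A] `<=` carrier p by apply: sub.
  apply: (invertible_cancel prime_invertible) => //; first exact: is_ideal_prime.
  rewrite ideal_mulT; last exact: is_ideal_prime.
  by move=> x px; apply: contrapT => nx; apply: h; exists x.
have an : a != 0 by apply: contra_not_neq np2 => ->; case: (ideal_mul_ideal (carrier p) (carrier p)).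
exists a => //; split=> //; apply/eqP; rewrite eqn_leq exponent_in // andbT leqNgt.
apply: contra_notN np2; have [s [es os ->]] := dedekind_factorization an.
case e : (count_mem p s) => [|[|m]] // _.
have: ideal_prod s a by rewrite -es; apply: principal_self.
rewrite ideal_prod_sort e /= -/(carrier p) ideal_mulA -ideal_mulA.
by apply: ideal_mul_subl; apply: ideal_mul_ideal.
Qed.

(** Let (d) = p^m J with J prime to p. Any a in J outside p does it, since n lies in
p^m. *)
Lemma exponent_le_fraction n d : n != 0 -> d != 0 -> (ex d <= ex n)%N ->
  exists a u, a \notin p /\ a * n = d * u.
Proof.
move=> nn dn; have [s [es os ->]] := dedekind_factorization dn.
have [t [et ot ->]] := dedekind_factorization nn => le.
pose J := ideal_prod (filter (predC1 p) s).
have [a Ja ap] : exists2 a, J a & a \notin p.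
  apply: contrapT => h.
  suff : p \in filter (predC1 p) s by rewrite mem_filter /= eqxx.
  apply: prime_prod_maximal => [Q|x Jx]; first by rewrite mem_filter => /andP[_ /os].
  by apply: contrapT => /negP nx; apply: h; exists x.
have: ideal_prod s (a * n).
  rewrite ideal_prod_sort mulrC; apply: ideal_mul_in => //.
  have: ideal_prod t n by rewrite -et; apply: principal_self.
  rewrite ideal_prod_sort -(subnK le) addnC nseqD ideal_prod_cat -ideal_mulA.
  by apply: ideal_mul_subl; apply: ideal_prod_ideal.
by rewrite -es => -[u _ eu]; exists a, u.
Qed.

Lemma fraction_repr (x : {fraction A}) : x * tofrac \d_(repr x) = tofrac \n_(repr x).
Proof.
rewrite -{1}[x]reprK; set r := repr x; unlock tofrac.
rewrite -[LHS]FracField.pi_mul /FracField.mulf; apply/eqmodP.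
rewrite /= FracField.equivfE !numden_Ratio ?oner_eq0 ?mulf_neq0 ?denom_ratioP ?oner_eq0 //.
by rewrite !mulr1 mulrC.
Qed.

Lemma fractionP (x : {fraction A}) : exists n d, d != 0 /\ x = tofrac n / tofrac d.
Proof.
have dn := denom_ratioP (repr x).
exists \n_(repr x), \d_(repr x); split=> //.
by rewrite -fraction_repr mulfK // tofrac_eq0.
Qed.

(** The valuation is defined through a chosen fraction; additivity of the exponent
makes it independent of the choice. *)
Lemma padic_valE n d : n != 0 -> d != 0 ->
  padic_val p (tofrac n / tofrac d) = (ex n)%:Z - (ex d)%:Z.
Proof.
move=> nn dn; set x := _ / _.
have Fdn : tofrac d != 0 by rewrite tofrac_eq0.
have xn : x != 0 by rewrite mulf_neq0 ?invr_eq0 ?tofrac_eq0.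
have dn' := denom_ratioP (repr x).
have nn' : \n_(repr x) != 0 by rewrite -tofrac_eq0 -fraction_repr mulf_neq0 ?tofrac_eq0.
rewrite /padic_val !ideal_gen1.
have e : n * \d_(repr x) = \n_(repr x) * d.
  by apply/eqP; rewrite -tofrac_eq !tofracM -fraction_repr /x mulrAC divfK // mulrC.
have := congr1 (fun y => ex y) e; rewrite !exponentM // => /(congr1 Posz).
rewrite !PoszD => h; apply/eqP; rewrite subr_eq addrAC eq_sym subr_eq h; exact/eqP.
Qed.

Local Notation v := (padic_val p).

Lemma padic_val_tofrac a : a != 0 -> v (tofrac a) = (ex a)%:Z.
Proof.
move=> an; rewrite -[tofrac a]divr1 -tofrac1 padic_valE ?oner_eq0 //.
by rewrite (@exponent_notin 1) ?subr0 // (idealr1 (p : idealr A)).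
Qed.

Lemma padic_val_ge0 a : a != 0 -> 0 <= v (tofrac a).
Proof. by move=> an; rewrite padic_val_tofrac. Qed.

Lemma padic_val_in a : a != 0 -> a \in p -> 1 <= v (tofrac a).
Proof. by move=> an ap; rewrite padic_val_tofrac // lez_nat exponent_in. Qed.

Lemma padic_val_notin a : a \notin p -> v (tofrac a) = 0.
Proof.
move=> ap; rewrite padic_val_tofrac ?exponent_notin //.
by apply: contraNneq ap => ->; exact: (idealr0 (p : idealr A)).
Qed.

Lemma padic_val_uniformizer : exists2 a, a \in p & a != 0 /\ v (tofrac a) = 1.
Proof. by have [a ap [an e]] := uniformizer; exists a => //; rewrite padic_val_tofrac ?e. Qed.

(** The valuation ring of K is the localization of A at p. *)
Lemma padic_val_ge0P (x : {fraction A}) : x != 0 -> 0 <= v x ->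
  exists a u, a \notin p /\ x = tofrac u / tofrac a.
Proof.
have [n [d [dn ->]]] := fractionP x => xn.
have nn : n != 0 by apply: contra_neq xn => ->; rewrite tofrac0 mul0r.
rewrite padic_valE // subr_ge0 lez_nat => /(exponent_le_fraction nn dn)[a [u [ap e]]].
exists a, u; split=> //.
have an : a != 0 by apply: contraNneq ap => ->; exact: (idealr0 (p : idealr A)).
apply/eqP; rewrite eqr_div ?tofrac_eq0 // -!tofracM; apply/eqP; congr tofrac.
by rewrite mulrC e mulrC.
Qed.

Lemma prime_maximal : maximal_ideal p.
Proof. by have [_ _] := hA; apply. Qed.

Lemma padic_valM x y : x != 0 -> y != 0 -> v (x * y) = v x + v y.
Proof.
have [n [d [dn ->]]] := fractionP x; have [m [e [en ->]]] := fractionP y => xn yn.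
have nn : n != 0 by apply: contra_neq xn => ->; rewrite tofrac0 mul0r.
have mn : m != 0 by apply: contra_neq yn => ->; rewrite tofrac0 mul0r.
rewrite mulf_div -!tofracM !padic_valE ?mulf_neq0 // !exponentM // !PoszD.
by rewrite opprD addrACA.
Qed.

Lemma padic_valV x : x != 0 -> v x^-1 = - v x.
Proof.
move=> xn; have v1 : v 1 = 0.
  by rewrite -(tofrac1 A) padic_val_notin // (idealr1 (p : idealr A)).
by apply: (addrI (v x)); rewrite subrr -padic_valM ?invr_eq0 // mulfV.
Qed.

Lemma prod_notin m (a : 'I_m -> A) : (forall i, a i \notin p) -> \prod_i a i \notin p.
Proof.
move=> ha; elim/big_ind: _ => // [|x y xp yp]; first by rewrite (idealr1 (p : idealr A)).
by have /= -> := prime_idealrM p x y; rewrite negb_or xp.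
Qed.

Lemma common_denominator m (q : 'I_m -> {fraction A}) :
  (forall i, q i != 0 -> 0 <= v (q i)) ->
  exists2 a, a \notin p & exists c : 'I_m -> A, forall i, tofrac a * q i = tofrac (c i).
Proof.
move=> hq.
have /choice[au hau] : forall i, exists au : A * A, au.1 \notin p /\ tofrac au.1 * q i = tofrac au.2.
  move=> i; have [q0|qn] := eqVneq (q i) 0.
    by exists (1, 0); rewrite q0 mulr0 tofrac0 (idealr1 (p : idealr A)).
  have [a [u [ap ->]]] := padic_val_ge0P qn (hq i qn); exists (a, u); split=> //=.
  have an : a != 0 by apply: contraNneq ap => ->; exact: (idealr0 (p : idealr A)).
  by rewrite mulrCA mulfV ?mulr1 // tofrac_eq0.
exists (\prod_i (au i).1); first by apply: prod_notin => i; case: (hau i).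
exists (fun i => (\prod_(j | j != i) (au j).1) * (au i).2) => i.
have [_ e] := hau i; rewrite (bigD1 i) //= [(au i).1 * _]mulrC.
by rewrite !tofracM -mulrA e.
Qed.

End DedekindValuation.

(** * Dimension of subquotients over the residue field *)

Section RelativeDimension.
Variables (A B : comNzRingType) (phi : {rmorphism A -> B}) (p : idealr A).
Hypothesis pmax : maximal_ideal p.
Implicit Types (I J H : set B).

Definition lincomb n (b : 'I_n -> B) (c : 'I_n -> A) := \sum_i phi (c i) * b i.

Definition independent I n (b : 'I_n -> B) :=
  forall c, I (lincomb b c) -> forall i, c i \in p.

(** J/I is a vector space over A/p when p J is inside I; b represents a basis of it.
Coefficients stay in A, and those of a relation modulo I lie in p. *)
Definition rel_basis I J n (b : 'I_n -> B) :=
  [/\ forall i, J (b i), forall x, J x -> exists c, I (x - lincomb b c) & independent I b].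

Definition rel_dim I J n := exists b : 'I_n -> B, rel_basis I J b.

Definition cat_fam (T : Type) m n (b : 'I_m -> T) (d : 'I_n -> T) (i : 'I_(m + n)) :=
  match fintype.split i with inl j => b j | inr j => d j end.

Lemma cat_famP T m n (b : 'I_m -> T) (d : 'I_n -> T) :
  (forall j, cat_fam b d (lshift n j) = b j) /\ (forall j, cat_fam b d (rshift m j) = d j).
Proof.
split=> j; rewrite /cat_fam.
  by have := unsplitK (inl j : 'I_m + 'I_n) => /= ->.
by have := unsplitK (inr j : 'I_m + 'I_n) => /= ->.
Qed.

Lemma lincomb_split m n (b : 'I_(m + n) -> B) c :
  lincomb b c = lincomb (fun j => b (lshift n j)) (fun j => c (lshift n j))
              + lincomb (fun j => b (rshift m j)) (fun j => c (rshift m j)).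
Proof. by rewrite /lincomb big_split_ord. Qed.

Lemma eq_lincomb n (b b' : 'I_n -> B) c c' : b =1 b' -> c =1 c' -> lincomb b c = lincomb b' c'.
Proof. by move=> eb ec; apply: eq_bigr => i _; rewrite eb ec. Qed.

Lemma lincomb_in I n (b : 'I_n -> B) c :
  is_ideal I -> (forall i, I (phi (c i) * b i)) -> I (lincomb b c).
Proof. by move=> hI h; apply: is_ideal_sum. Qed.

(** A basis of H/J followed by one of J/I; the coefficients of a relation on the
former are in p first, and pH inside I then removes these terms. *)
Lemma rel_dim_tower I J H m n : is_ideal I -> is_ideal J -> I `<=` J -> J `<=` H ->
  (forall a x, a \in p -> H x -> I (phi a * x)) ->
  rel_dim I J m -> rel_dim J H n -> rel_dim I H (m + n).
Proof.
move=> hI hJ IJ JH pH [b [bJ bspan bind]] [d [dH dspan dind]].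
have [el er] := cat_famP b d.
exists (cat_fam b d); split=> [i|x Hx|c hc i].
- by rewrite /cat_fam; case: fintype.splitP => j _; [apply: JH|apply: dH].
- have [c2 h2] := dspan x Hx; have [c1 h1] := bspan _ h2.
  have [fl fr] := cat_famP c1 c2.
  exists (cat_fam c1 c2); rewrite lincomb_split (eq_lincomb el fl) (eq_lincomb er fr).
  by rewrite opprD addrA addrAC.
move: hc; rewrite lincomb_split (eq_lincomb el (frefl _)) (eq_lincomb er (frefl _)) => hc.
have c2 : forall j, c (rshift m j) \in p.
  apply: dind; rewrite -[X in J X](addKr (lincomb b (fun j => c (lshift n j)))) addrC.
  apply: is_idealB => //; first exact: IJ.
  by apply: lincomb_in => // j; apply: is_idealM.
have c1 : forall j, c (lshift n j) \in p.
  apply: bind; rewrite -[X in I X](addrK (lincomb d (fun j => c (rshift m j)))).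
  apply: is_idealB => //; apply: lincomb_in => // j; exact: pH.
by rewrite -(splitK i); case: (fintype.split i) => j; [apply: c1|apply: c2].
Qed.

(** A longest independent family is a basis: if adding x makes it dependent, the
coefficient of x is invertible modulo p. *)
Lemma rel_dim_exists I H N : is_ideal I -> is_ideal H -> I `<=` H ->
  (forall a x, a \in p -> H x -> I (phi a * x)) ->
  (forall n (b : 'I_n -> B), (forall i, H (b i)) -> independent I b -> (n <= N)%N) ->
  exists n, rel_dim I H n.
Proof.
move=> hI hH IH pH bound.
pose Q n := `[< exists b : 'I_n -> B, (forall i, H (b i)) /\ independent I b >].
have Q0 : exists n, Q n.
  by exists 0%N; apply/asboolP; exists (fun=> 0); split=> [[]|c _ []].
have QN n : Q n -> (n <= N)%N.
  by move=> /asboolP[b [hb ib]]; apply: bound ib.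
case: (ex_maxnP Q0 QN) => n /asboolP[b [hb ib]] nmax.
exists n, b; split=> // x Hx; apply: contrapT => nspan.
suff : Q n.+1 by move=> /nmax; rewrite ltnn.
apply/asboolP; exists (fun i => oapp b x (unlift ord0 i)); split=> [i|c].
  by case: unliftP => [j _|_] //=; apply: hb.
rewrite /lincomb big_ord_recl unlift_none /=.
under eq_bigr do rewrite liftK /=.
rewrite -[\sum_i _]/(lincomb b (fun i => c (lift ord0 i))).
set c0 := c ord0; set S := lincomb _ _ => hc.
have c0p : c0 \in p.
  apply: contrapT => /negP c0p; apply: nspan.
  have [a ha] := maximal_inverse pmax c0p.
  exists (fun i => - a * c (lift ord0 i)).
  have -> : lincomb b (fun i => - a * c (lift ord0 i)) = - (phi a * S).
    rewrite /S /lincomb mulr_sumr -sumrN; apply: eq_bigr => i _.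
    by rewrite rmorphM rmorphN mulrA !mulNr.
  have -> : x - - (phi a * S) = phi (1 - c0 * a) * x + phi a * (phi c0 * x + S).
    rewrite rmorphB rmorph1 rmorphM mulrBl mul1r mulrDr opprK addrA mulrA.
    by rewrite (mulrC (phi a) (phi c0)) subrK.
  by apply: is_idealD => //; [apply: pH|apply: is_idealM].
move=> i; case: (unliftP ord0 i) => [j ->|->] //.
apply: (ib (fun i => c (lift ord0 i))).
rewrite -/S -[X in I X](addKr (phi c0 * x)) addrC.
by apply: is_idealB => //; apply: pH.
Qed.

(** Multiplication by an x in J outside PJ is an isomorphism from B/P to J/PJ. It is
onto because (x) = J X with X not inside P, so X + P is the whole ring. *)
Lemma rel_dim_mul (P : prime_ideal B) J f : maximal_ideal P -> is_ideal J -> invertible J ->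
  rel_dim (carrier P) setT f -> rel_dim (ideal_mul (carrier P) J) J f.
Proof.
move=> Pmax hJ Jinv [b [_ bspan bind]].
have hP := is_ideal_prime P; set PJ := ideal_mul _ J.
have hPJ : is_ideal PJ by apply: ideal_mul_ideal.
have [x Jx nx] : exists2 x, J x & ~ PJ x.
  apply: contrapT => h; apply: (@prime_not1 _ P).
  suff sub : [set: B] `<=` carrier P by apply: sub.
  apply: (invertible_cancel Jinv) => //; rewrite ideal_mulT // ideal_mulC.
  by move=> y Jy; apply: contrapT => ny; apply: h; exists y.
exists (fun i => b i * x); have ex c : lincomb (fun i => b i * x) c = lincomb b c * x.
  by rewrite /lincomb mulr_suml; apply: eq_bigr => i _; rewrite mulrA.
split=> [i|y Jy|c]; first exact: is_idealM.
  have [X hX eX] : exists2 X, is_ideal X & principal x = ideal_mul J X.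
    apply: invertible_factor => //; first exact: principal_ideal.
    by move=> _ [u _ <-]; apply: is_idealMr.
  have [z Xz Pz] : exists2 z, X z & z \notin P.
    apply: contrapT => h; apply: nx.
    have: principal x x by apply: principal_self.
    rewrite eX (ideal_mulC J); apply: ideal_mulS => // z Xz.
    by apply: contrapT => /negP Pz; apply: h; exists z.
  have [u hu] := maximal_inverse Pmax Pz.
  have : ideal_mul J X (y * z) by apply: ideal_mul_in.
  rewrite -eX => -[r _ er].
  have [c hc] := bspan (r * u) I; exists c; rewrite ex.
  have -> : y - lincomb b c * x = (1 - z * u) * y + (r * u - lincomb b c) * x.
    have e : r * u * x = z * u * y by rewrite mulrC mulrA er [RHS]mulrC mulrA.
    by rewrite !mulrBl mul1r e addrA subrK.
  by apply: is_idealD => //; apply: ideal_mul_in.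
rewrite ex => hc; apply: bind; apply: contrapT => /negP nP.
have [u hu] := maximal_inverse Pmax nP; apply: nx.
rewrite -[x](subrK (lincomb b c * u * x)); apply: is_idealD => //.
  by rewrite -{1}[x]mul1r -mulrBl; apply: ideal_mul_in.
by rewrite mulrAC; apply: is_idealMr.
Qed.

Lemma ideal_prod_invertible (s : seq (prime_ideal B)) :
  (forall P, P \in s -> invertible (carrier P)) -> invertible (ideal_prod s).
Proof.
elim: s => [_|P s IH hs].
  exists setT, 1; split=> //; first exact: lreg1.
  by rewrite ideal_mulT //; apply/seteqP; split=> // x _; exists x; rewrite ?mul1r.
rewrite ideal_prod_cons; apply: invertible_mul; first by apply: hs; rewrite inE eqxx.
by apply: IH => Q Qs; apply: hs; rewrite inE Qs orbT.
Qed.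

Lemma rel_dim_prod (s : seq (prime_ideal B)) (f : prime_ideal B -> nat) :
  (forall P : prime_ideal B, P \in s ->
    [/\ maximal_ideal P, invertible (carrier P) & rel_dim (carrier P) setT (f P)]) ->
  (forall a x, a \in p -> ideal_prod s (phi a * x)) ->
  rel_dim (ideal_prod s) setT (\sum_(P <- s) f P).
Proof.
elim: s => [_ _|P s IH hs ps].
  by rewrite big_nil; exists (fun=> 0); split=> [[]|x _|c _ []] //; exists (fun=> 0).
rewrite big_cons ideal_prod_cons.
have [Pmax Pinv Pf] := hs P (mem_head _ _).
have sub : ideal_prod (P :: s) `<=` ideal_prod s.
  by apply: ideal_mul_subr; apply: ideal_prod_ideal.
have hs' Q : Q \in s -> [/\ maximal_ideal Q, invertible (carrier Q) & rel_dim (carrier Q) setT (f Q)].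
  by move=> Qs; apply: hs; rewrite inE Qs orbT.
apply: (@rel_dim_tower _ (ideal_prod s)) => //.
- exact: ideal_mul_ideal.
- exact: ideal_prod_ideal.
- by move=> a x ap _; apply: ps.
- apply: rel_dim_mul => //; first exact: ideal_prod_ideal.
  by apply: ideal_prod_invertible => Q /hs'[].
by apply: IH => // a x ap; apply/sub/ps.
Qed.

End RelativeDimension.

(** * The integral closure B and the ideal pB *)

Section IntegralClosureRing.
Variables (A : idomainType) (L : fieldExtType {fraction A}).
Local Notation B := (integral_closure L).

Lemma int_valM (x y : B) : val (x * y) = val x * val y.
Proof. by rewrite rmorphM. Qed.
Lemma integral_closureP (x : L) : integralOver (@to_ext A L) x -> exists b : B, val b = x.
Proof. by move=> /asboolP hx; exists (IntegralClosure (hx : x \in @integral_pred A L)). Qed.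

Lemma val_integral (b : B) : integralOver (@to_ext A L) (val b).
Proof. by have := int_valP b => /asboolP. Qed.

Lemma integral_closure_lreg (c : B) : GRing.lreg c <-> c != 0.
Proof.
split; first exact: lreg_neq0.
move=> cn x y e; apply: val_inj; apply: (@mulfI _ (val c)).
  by rewrite -(rmorph0 (val : {rmorphism B -> L})) (inj_eq val_inj).
by rewrite -!int_valM e.
Qed.

(** Integrality is transitive, so B is integrally closed in L. *)
Lemma integral_over_closure (x : L) :
  integralOver (val : {rmorphism B -> L}) x -> exists b : B, val b = x.
Proof.
case=> f fmon fx; apply: integral_closureP.
apply: (integral_root_monic _ fx); first by rewrite monic_map.
apply/integral_poly => i; rewrite coef_map; exact: val_integral.
Qed.
End IntegralClosureRing.

Section Extension.
Variables (A B : comNzRingType) (phi : {rmorphism A -> B}).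
Hypothesis phi_lreg : forall c, GRing.lreg c -> GRing.lreg (phi c).
Implicit Types I J : set A.

(** For the inclusion of A in B, this is I B. *)
Definition extension I : set B := ideal_gen (phi @` I).

Lemma extension_in I a : I a -> extension I (phi a).
Proof. by move=> Ia; apply: ideal_gen_sub; exists a. Qed.

Lemma extension_ideal I : is_ideal (extension I).
Proof. exact: ideal_gen_ideal. Qed.

Lemma preimage_ideal (X : set B) : is_ideal X -> is_ideal (phi @^-1` X).
Proof.
move=> hX; split=> [|a x y] /=; first by rewrite rmorph0; case: hX.
by move=> Xx Xy; rewrite rmorphD rmorphM; case: hX => _; apply.
Qed.

Lemma extension_min I (X : set B) : is_ideal X -> (forall a, I a -> X (phi a)) ->
  extension I `<=` X.
Proof. by move=> hX h; apply: ideal_gen_min => // _ [a Ia <-]; apply: h. Qed.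

Lemma extension_mul I J :
  ideal_mul (extension I) (extension J) = extension (ideal_mul I J).
Proof.
have hE := extension_ideal (ideal_mul I J).
apply/seteqP; split; last first.
  apply: extension_min; first exact: ideal_mul_ideal.
  suff sub : ideal_mul I J `<=` phi @^-1` (ideal_mul (extension I) (extension J)) by exact: sub.
  apply: ideal_mul_min; first exact/preimage_ideal/ideal_mul_ideal.
  by move=> x y Ix Jy /=; rewrite rmorphM; apply: ideal_mul_in; apply: extension_in.
apply: ideal_mul_min => // x y hx hy.
have sub : extension I `<=` [set x | extension (ideal_mul I J) (x * y)].
  apply: extension_min => [|a Ia]; first exact: is_ideal_transporter.
  rewrite /= mulrC.
  have sub : extension J `<=` [set y | extension (ideal_mul I J) (y * phi a)].
    apply: extension_min => [|b Jb]; first exact: is_ideal_transporter.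
    by rewrite /= -rmorphM; apply: extension_in; rewrite mulrC; apply: ideal_mul_in.
  exact: sub.
exact: sub.
Qed.

Lemma extension_principal c : extension (principal c) = principal (phi c).
Proof.
apply/seteqP; split.
  apply: extension_min; first exact: principal_ideal.
  by move=> _ [x _ <-]; exists (phi x); rewrite ?rmorphM.
move=> _ [x _ <-]; apply: is_idealMr; first exact: extension_ideal.
by apply: extension_in; apply: principal_self.
Qed.

Lemma extension_invertible I : invertible I -> invertible (extension I).
Proof.
move=> [J [c [hJ cr e]]]; exists (extension J), (phi c); split.
- exact: extension_ideal.
- exact: phi_lreg.
by rewrite extension_mul e extension_principal.
Qed.

End Extension.

Section PrimeExtension.
Variables (A : idomainType) (hA : dedekind A) (L : fieldExtType {fraction A}).
Local Notation B := (integral_closure L).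
Variable p : prime_ideal A.
Hypothesis hp : exists2 x, x \in p & x != 0.
Local Notation phi := (to_int L).
Local Notation v := (padic_val p).
Local Notation pB := (extension phi (carrier p)).

Lemma int_val_eq0 (b : B) : (val b == 0) = (b == 0).
Proof. by rewrite -(rmorph0 (val : {rmorphism B -> L})) (inj_eq val_inj). Qed.

Lemma to_ext_eq0 a : (@to_ext A L a == 0) = (a == 0).
Proof. by rewrite /to_ext /= scaler_eq0 oner_eq0 orbF tofrac_eq0. Qed.

Lemma to_int_lreg c : GRing.lreg c -> GRing.lreg (phi c).
Proof.
move=> creg; apply/integral_closure_lreg; rewrite -int_val_eq0 to_ext_eq0.
exact: lreg_neq0.
Qed.

Lemma pB_invertible : invertible pB.
Proof. exact: (extension_invertible to_int_lreg (prime_invertible hA hp)). Qed.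

Lemma val_lincomb n (b : 'I_n -> B) c :
  val (lincomb phi b c) = \sum_i tofrac (c i) *: val (b i).
Proof.
rewrite rmorph_sum; apply: eq_bigr => i _.
by rewrite [LHS]rmorphM /= /to_ext /= -scalerAl mul1r.
Qed.

(** A relation over K is divided by a coefficient of least valuation; clearing
denominators prime to p gives a relation over A with a coefficient outside p. *)
Lemma independent_bound n (b : 'I_n -> B) : independent phi p pB b -> (n <= \dim {:L})%N.
Proof.
move=> ind; pose X := [tuple val (b i) | i < n].
suff /eqP : free X by rewrite size_tuple => <-; apply/dimvS/subvf.
apply/freeP => q hq; apply: contrapT => nz.
have [i0 qi0 qmin] : exists2 i0, q i0 != 0 & forall i, q i != 0 -> v (q i0) <= v (q i).
  have [i1 qi1] : exists i, q i != 0.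
    by apply: contrapT => h; apply: nz => i; apply/eqP/negPn/negP => qi; apply: h; exists i.
  by case: (@arg_minP _ _ _ i1 (fun i => q i != 0) (fun i => v (q i)) qi1) => i; exists i.
have quot_ge0 i : q i / q i0 != 0 -> 0 <= v (q i / q i0).
  rewrite mulf_eq0 invr_eq0 negb_or => /andP[qi _].
  by rewrite (padic_valM hA) ?invr_eq0 // (padic_valV hA) // subr_ge0 qmin.
have [a ap [c hc]] := common_denominator hA quot_ge0.
have : c i0 \in p.
  apply: (ind c); suff -> : lincomb phi b c = 0 by case: (extension_ideal phi (carrier p)).
  apply: val_inj; rewrite val_lincomb rmorph0.
  have -> : \sum_i tofrac (c i) *: val (b i) = (tofrac a / q i0) *: \sum_i q i *: X`_i.
    rewrite scaler_sumr; apply: eq_bigr => i _; rewrite -hc scalerA (nth_map i) ?size_enum_ord //.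
    by rewrite nth_ord_enum mulrA mulrAC.
  by rewrite hq scaler0.
suff -> : c i0 = a by rewrite (negPf ap).
by apply/eqP; rewrite -tofrac_eq -hc mulfV // mulr1.
Qed.

End PrimeExtension.

(** * Factorization of pB and the sum of the local degrees *)

Section PrimesOver.
Variables (A : idomainType) (hA : dedekind A) (L : fieldExtType {fraction A}).
Local Notation B := (integral_closure L).
Variable p : prime_ideal A.
Hypothesis hp : exists2 x, x \in p & x != 0.
Local Notation phi := (to_int L).
Local Notation pB := (extension phi (carrier p)).
Implicit Types (P : prime_ideal B) (J : set B).

Let pBideal := extension_ideal phi (carrier p).

Lemma pB_mul a x : a \in p -> pB (phi a * x).
Proof. by move=> ap; apply: is_idealMr => //; apply: extension_in. Qed.

Lemma bound_over J n (b : 'I_n -> B) : pB `<=` J -> independent phi p J b -> (n <= \dim {:L})%N.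
Proof. by move=> pJ ind; apply: (independent_bound hA (b := b)) => c /pJ; apply: ind. Qed.

Lemma rel_dim_over J J' : is_ideal J -> is_ideal J' -> pB `<=` J -> J `<=` J' ->
  exists n, rel_dim phi p J J' n.
Proof.
move=> hJ hJ' pJ JJ'; apply: (rel_dim_exists (prime_maximal hA hp)) => //.
  by move=> a x ap _; apply/pJ/pB_mul.
by move=> n b _; apply: bound_over.
Qed.

(** J is generated by generators of p and a basis of J/pB. *)
Lemma fin_gen_over J : is_ideal J -> pB `<=` J -> fin_gen J.
Proof.
move=> hJ pJ; have [n [b [bJ bspan _]]] := rel_dim_over pBideal hJ (@subset_refl _ _) pJ.
have [s es] := dedekind_fin_gen hA (is_ideal_prime p).
pose gens := map phi s ++ codom b.
have hG := ideal_gen_ideal [set x | x \in gens].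
exists gens; apply/seteqP; split=> [x Jx|]; last first.
  apply: ideal_gen_min => // x /=; rewrite mem_cat => /orP[/mapP[a as_ ->]|/codomP[i ->]] //.
  apply/pJ/extension_in; rewrite es; exact: ideal_gen_sub.
have [c hc] := bspan x Jx.
rewrite -(subrK (lincomb phi b c) x); apply: is_idealD => //.
  suff sub : pB `<=` ideal_gen [set x | x \in gens] by apply: sub.
  apply: extension_min => // a; rewrite es => ha.
  suff sub : ideal_gen [set x | x \in s] `<=` phi @^-1` (ideal_gen [set x | x \in gens]) by apply: sub.
  apply: ideal_gen_min; first exact: preimage_ideal.
  by move=> y ys /=; apply: ideal_gen_sub; rewrite /= mem_cat map_f.
apply: lincomb_in => // i; apply: is_idealM => //.
by apply: ideal_gen_sub; rewrite /= mem_cat codom_f orbT.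
Qed.

(** B/P is a domain of finite dimension over a field. For x outside P, take a
relation between the powers of x modulo P; after division by a power of x its
constant term is a unit modulo P, which gives an inverse of x. *)
Lemma prime_over_maximal P : pB `<=` carrier P -> maximal_ideal P.
Proof.
move=> pP; apply: inverse_maximal => x xP.
have hP := is_ideal_prime P.
pose N := \dim {:L}.
have [c hc [i ci]] : exists2 c : 'I_N.+1 -> A,
    lincomb phi (fun i : 'I_N.+1 => x ^+ i) c \in P & exists i, c i \notin p.
  apply: contrapT => h.
  suff /(bound_over pP) : independent phi p (carrier P) (fun i : 'I_N.+1 => x ^+ i) by rewrite ltnn.
  by move=> c hc i; apply: contrapT => /negP ci; apply: h; exists c => //; exists i.
(* The relation is divided by x ^+ k, where k is the least index whose coefficient
   is not in p. *)
have [k ck kmin] : exists2 k : 'I_N.+1, c k \notin p & forall j : 'I_N.+1, c j \notin p -> (k <= j)%N.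
  by case: (@arg_minnP _ i (fun i => c i \notin p) (fun i => val i) ci) => k; exists k.
pose w := \sum_(j : 'I_N.+1 | (k < j)%N) phi (c j) * x ^+ (j - k.+1).
have: x ^+ k * (phi (c k) + x * w) \in P.
  have -> : x ^+ k * (phi (c k) + x * w) =
      lincomb phi (fun i : 'I_N.+1 => x ^+ i) c - \sum_(j : 'I_N.+1 | (j < k)%N) phi (c j) * x ^+ j.
    rewrite /lincomb (bigID (fun j : 'I_N.+1 => (j < k)%N)) /= [LHS]mulrDr.
    rewrite [X in _ = X - _]addrC addrK (bigD1 k) ?ltnn //=; congr (_ + _); first by rewrite mulrC.
    rewrite mulrA -exprSr mulr_sumr; apply: eq_big => [j|j kj].
      by rewrite -leqNgt ltn_neqAle eq_sym andbC.
    by rewrite mulrCA -exprD subnKC.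
  apply: rpredB => //; apply: rpred_sum => j jk.
  apply/pP/pB_mul; apply: contrapT => /negP /kmin; by rewrite leqNgt jk.
have xk : x ^+ k \notin P.
  elim: (k : nat) => [|m IH]; first by rewrite expr0 (idealr1 (P : idealr B)).
  rewrite exprS; have /= -> := prime_idealrM P x (x ^+ m).
  by rewrite negb_or xP.
have /= -> := prime_idealrM P (x ^+ k) (phi (c k) + x * w); rewrite (negPf xk) /= => h.
have [a ha] := maximal_inverse (prime_maximal hA hp) ck.
exists (- phi a * w).
have -> : 1 - x * (- phi a * w) = phi (1 - c k * a) + phi a * (phi (c k) + x * w).
  rewrite rmorphB rmorph1 rmorphM mulrDr addrA (mulrC (phi a) (phi (c k))) subrK.
  by rewrite mulNr mulrN opprK mulrCA.
apply: rpredD; last exact: idealMr.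
by apply/pP/extension_in.
Qed.

Lemma closed_over J : is_ideal J -> fin_gen J -> pB `<=` J -> forall c y, GRing.lreg c ->
  (forall x, J x -> exists2 z, J z & y * x = c * z) -> principal c y.
Proof.
move=> hJ fJ pJ c y /integral_closure_lreg cn h.
have vcn : val c != 0 by rewrite int_val_eq0.
have [|b hb] := @integral_over_closure _ L (val y / val c).
  apply: (@stable_integral _ _ (val : {rmorphism B -> L}) J) h => //.
  have [a ap an] := hp; exists (phi a); first exact/pJ/extension_in.
  by rewrite to_ext_eq0.
exists b => //; apply: val_inj.
by rewrite rmorphM /= hb mulrCA mulfV // mulr1.
Qed.

(** If P contains pB then the contraction of P to A contains p, which is maximal,
so it equals p. *)
Lemma primes_overE P : primes_over L p P <-> pB `<=` carrier P.
Proof.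
split=> [h|pP a].
  apply: extension_min; first exact: is_ideal_prime.
  by move=> a ap; rewrite /carrier /= h.
apply/idP/idP => [aP|ap]; last exact/pP/extension_in.
apply: contrapT => /negP /(maximal_inverse (prime_maximal hA hp))[b hb].
have := @prime_not1 _ P; apply.
have -> : 1 = phi (1 - a * b) + phi b * phi a.
  by rewrite -rmorphM -rmorphD mulrC subrK rmorph1.
apply: is_idealD; first exact: is_ideal_prime.
  exact/pP/extension_in.
by apply: is_idealM => //; apply: is_ideal_prime.
Qed.

Let pBinv := pB_invertible hA L hp.

Lemma prime_over_invertible P : pB `<=` carrier P -> invertible (carrier P).
Proof.
exact: (over_invertible pBideal pBinv fin_gen_over prime_over_maximal closed_over).
Qed.

Lemma pB_factorization : exists s,
  [/\ pB = ideal_prod s, primes_over L p = [set` s]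
    & forall P, ramification_index p P = count_mem P s].
Proof.
have [s os es] := factorization pBideal pBinv fin_gen_over prime_over_maximal closed_over
  pBideal (@subset_refl _ _).
exists s; split=> // [|P].
  apply/seteqP; split=> [P /primes_overE pP|P /os pP]; last exact/primes_overE.
  by apply: prime_prod_maximal => [Q /os|]; [apply: prime_over_maximal|rewrite -es].
rewrite /ramification_index -/pB es.
apply: (ideal_exponentE pBideal pBinv fin_gen_over prime_over_maximal closed_over).
by rewrite es.
Qed.

Section ResidueDegree.
Variable P : prime_ideal B.
Hypothesis Pp : primes_over L p P.

Lemma residue_map_pi (a : A) :
  residue_map p P (\pi_({ideal_quot p}) a) = \pi_({ideal_quot P}) (phi a).
Proof.
apply/eqP; rewrite -Quotient.idealrBE -rmorphB Pp Quotient.idealrBE reprK; exact/eqP.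
Qed.

Lemma pi_lincomb n (b : 'I_n -> B) (c : 'I_n -> A) :
  \pi_({ideal_quot P}) (lincomb phi b c) =
  \sum_i residue_map p P (\pi_({ideal_quot p}) (c i)) * \pi_({ideal_quot P}) (b i).
Proof.
by rewrite rmorph_sum; apply: eq_bigr => i _; rewrite residue_map_pi rmorphM.
Qed.

(** The two notions of basis of B/P over A/p agree: one takes coefficients in the
quotient, the other takes representatives. *)
Lemma has_degree_residue n :
  has_degree (residue_map p P) n <-> rel_dim phi p (carrier P) setT n.
Proof.
split=> [[bq hb]|[b [_ bspan bind]]].
  exists (fun i => repr (bq i)); have rK i : \pi_({ideal_quot P}) (repr (bq i)) = bq i by rewrite reprK.
  split=> // [x _|c hc i].
    have [c [ec _]] := hb (\pi_({ideal_quot P}) x).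
    exists (fun i => repr (c i)); rewrite /carrier /= Quotient.idealrBE pi_lincomb ec.
    by apply/eqP; apply: eq_bigr => i _; rewrite rK reprK.
  have [c0 [_ c0u]] := hb 0.
  have e1 : c0 = [ffun i => \pi_({ideal_quot p}) (c i)].
    have e : \pi_({ideal_quot P}) (lincomb phi (fun i => repr (bq i)) c) = 0.
      by apply/eqP; rewrite pi_eq0.
    by apply: c0u; rewrite -[LHS]e pi_lincomb; apply: eq_bigr => j _; rewrite ffunE rK.
  have e2 : c0 = [ffun i => \pi_({ideal_quot p}) 0].
    apply: c0u; rewrite big1 // => j _; rewrite ffunE residue_map_pi !rmorph0 mul0r //.
  have := congr1 (fun f : {ffun _} => f i) (etrans (esym e1) e2).
  by rewrite !ffunE rmorph0 => /eqP; rewrite pi_eq0.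
exists (fun i => \pi_({ideal_quot P}) (b i)) => x.
have sumE (c : {ffun 'I_n -> {ideal_quot p}}) :
    \sum_i residue_map p P (c i) * \pi_({ideal_quot P}) (b i) =
    \pi_({ideal_quot P}) (lincomb phi b (fun i => repr (c i))).
  by rewrite pi_lincomb; apply: eq_bigr => i _; rewrite reprK.
have [c hc] := bspan (repr x) I.
exists [ffun i => \pi_({ideal_quot p}) (c i)]; split.
  move: hc; rewrite /carrier /= Quotient.idealrBE pi_lincomb reprK => /eqP->.
  by apply: eq_bigr => i _; rewrite ffunE.
move=> c' hc'; apply/ffunP => i; rewrite ffunE -[RHS]reprK; apply/eqP.
rewrite -Quotient.idealrBE; apply: (bind (fun i => c i - repr (c' i))).
have -> : lincomb phi b (fun i => c i - repr (c' i)) =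
    lincomb phi b c - lincomb phi b (fun i => repr (c' i)).
  rewrite /lincomb -sumrB; apply: eq_bigr => j _; by rewrite rmorphB mulrBl.
rewrite /carrier /= Quotient.idealrBE -sumE -hc'.
by move: hc; rewrite /carrier /= Quotient.idealrBE reprK => /eqP->.
Qed.

Lemma residue_finite : finite_degree (residue_map p P).
Proof.
have [n hn] : exists n, rel_dim phi p (carrier P) setT n.
  by apply: rel_dim_over => //; [apply: is_ideal_prime|apply/primes_overE].
by exists n; apply/has_degree_residue.
Qed.

Lemma residue_degreeP : rel_dim phi p (carrier P) setT (residue_degree p P).
Proof.
apply/has_degree_residue; rewrite /residue_degree /degree.
by case: xgetP => // h; have [n hn] := residue_finite; case: (h n).
Qed.

End ResidueDegree.

Lemma primes_over_finite : finite_set (primes_over L p).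
Proof. by have [s [_ -> _]] := pB_factorization; apply: finite_seq. Qed.

Lemma sum_over : rel_dim phi p pB setT
  (\sum_(P \in primes_over L p) (ramification_index p P * residue_degree p P)%N).
Proof.
have [s [es os ram]] := pB_factorization.
have oP P : P \in s -> primes_over L p P by rewrite os.
have -> : (\sum_(P \in primes_over L p) (ramification_index p P * residue_degree p P) =
    \sum_(P <- s) residue_degree p P)%N.
  have us : [set` s] = [set` undup s] by apply/seteqP; split=> P /=; rewrite mem_undup.
  rewrite os us -fsbig_seq ?undup_uniq // -[RHS]big_undup_iterop_count.
  apply: eq_bigr => P _; rewrite ram Monoid.iteropE /=.
  by elim: (count_mem P s) => [|m IH]; rewrite ?mul0n // mulSn IH.
rewrite es; apply: rel_dim_prod => [P Ps|a x ap].
  have /primes_overE pP := oP P Ps.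
  split; [exact: prime_over_maximal|exact: prime_over_invertible|].
  exact/residue_degreeP/oP.
by rewrite -es; apply: pB_mul.
Qed.

End PrimesOver.

(** * Discrete valuations and the completion *)

Section Valuation.
Variables (E : fieldType) (w : E -> int).
Hypothesis hw : valuation_axiom w.

(** x = 0 stands for infinite valuation, where w has no meaning. *)
Definition vge (N : int) (x : E) := (x == 0) || (N <= w x).

Lemma valuationM x y : x != 0 -> y != 0 -> w (x * y) = w x + w y.
Proof. by case: hw => h _; apply: h. Qed.

Lemma valuation1 : w 1 = 0.
Proof. by apply: (addrI (w 1)); rewrite -valuationM ?oner_eq0 // mulr1 addr0. Qed.

Lemma valuationV x : x != 0 -> w x^-1 = - w x.
Proof.
by move=> xn; apply: (addrI (w x)); rewrite -valuationM ?invr_eq0 // mulfV // valuation1 subrr.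
Qed.

Lemma valuationN x : x != 0 -> w (- x) = w x.
Proof.
move=> xn; rewrite -mulN1r valuationM ?oppr_eq0 ?oner_eq0 //.
suff -> : w (-1) = 0 by rewrite add0r.
have: w (-1) + w (-1) = 0 by rewrite -valuationM ?oppr_eq0 ?oner_eq0 // mulrNN mulr1 valuation1.
by move=> h; apply/eqP; move/eqP: h; rewrite -mulr2n mulrn_eq0.
Qed.

Lemma vge0 N : vge N 0. Proof. by rewrite /vge eqxx. Qed.

Lemma vgeN N x : vge N x -> vge N (- x).
Proof.
by rewrite /vge oppr_eq0; have [//|xn] := eqVneq x 0; rewrite valuationN.
Qed.

Lemma vgeD N x y : vge N x -> vge N y -> vge N (x + y).
Proof.
rewrite /vge; have [->|xn] := eqVneq x 0; first by rewrite add0r.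
have [->|yn] := eqVneq y 0; first by rewrite addr0 (negPf xn).
have [//|xyn /= hx hy] := eqVneq (x + y) 0.
case: hw => _ /(_ x y xn yn xyn); apply: le_trans.
by rewrite le_min hx hy.
Qed.

Lemma vgeB N x y : vge N x -> vge N y -> vge N (x - y).
Proof. by move=> hx /vgeN; apply: vgeD. Qed.

Lemma vgeM M N x y : vge M x -> vge N y -> vge (M + N) (x * y).
Proof.
rewrite /vge mulf_eq0; have [//|xn] := eqVneq x 0; have [//|yn /=] := eqVneq y 0.
by rewrite valuationM //; apply: lerD.
Qed.

Lemma vge_le M N x : M <= N -> vge N x -> vge M x.
Proof. by move=> MN /orP[/eqP->|h]; rewrite ?vge0 // /vge (le_trans MN h) orbT. Qed.

Lemma vge_sum N (T : Type) (r : seq T) (P : pred T) (F : T -> E) :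
  (forall i, P i -> vge N (F i)) -> vge N (\sum_(i <- r | P i) F i).
Proof. by move=> h; elim/big_ind: _ => //; [apply: vge0|apply: vgeD]. Qed.

Lemma vge1 : vge 0 1. Proof. by rewrite /vge valuation1 lexx orbT. Qed.

Lemma not_vge1 : ~~ vge 1 1. Proof. by rewrite /vge valuation1 oner_eq0. Qed.

Lemma vgeX x n : vge 1 x -> vge n%:Z (x ^+ n).
Proof.
move=> hx; elim: n => [|n IH]; first by rewrite expr0 vge1.
by rewrite exprS intS; apply: vgeM.
Qed.

Lemma vge_w x : vge (w x) x. Proof. by rewrite /vge lexx orbT. Qed.

Lemma nearP N x y : near_for w N x y <-> vge N (x - y).
Proof.
rewrite /near_for /vge subr_eq0; split=> [[->|->]|/orP[/eqP|]]; rewrite ?eqxx ?orbT //; first by left.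
by right.
Qed.

Definition valuation_ring : pred E := vge 0.

Lemma valuation_ring_subring : subring_closed valuation_ring.
Proof.
split; [exact: vge1|exact: vgeB|move=> x y hx hy].
by have := vgeM hx hy; rewrite addr0.
Qed.

End Valuation.

Section ValuationRing.
Variables (E : fieldType) (w : E -> int) (hw : valuation_axiom w).

(** The proof argument makes the axiom available to the subring instance. *)
Definition in_valuation_ring (_ : valuation_axiom w) : pred E := valuation_ring w.

HB.instance Definition _ := GRing.isSubringClosed.Build E (in_valuation_ring hw)
  (valuation_ring_subring hw).

Record valuation_integer := ValuationInteger
  { vint_val : E; vint_valP : vint_val \in in_valuation_ring hw }.

HB.instance Definition _ := [isSub for vint_val].
HB.instance Definition _ := [Choice of valuation_integer by <:].
HB.instance Definition _ := [SubChoice_isSubComNzRing of valuation_integer by <:].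
End ValuationRing.

Section Embedding.
Variables (A : idomainType) (hA : dedekind A) (p : prime_ideal A).
Hypothesis hp : exists2 x, x \in p & x != 0.
Variables (E : fieldType) (iota : {rmorphism {fraction A} -> E}) (w : E -> int).
Hypothesis hE : is_completion (padic_val p) iota w.

Lemma completion_valuation : valuation_axiom w.
Proof. by case: hE. Qed.
Let hw := completion_valuation.

Definition emb : A -> E := iota \o @tofrac A.
HB.instance Definition _ := GRing.RMorphism.on emb.

Lemma emb_eq0 a : (emb a == 0) = (a == 0).
Proof. by rewrite /emb /= fmorph_eq0 tofrac_eq0. Qed.

Lemma w_iota x : x != 0 -> w (iota x) = padic_val p x.
Proof. by case: hE => _ h _ _; apply: h. Qed.

Lemma emb_vge0 a : vge w 0 (emb a).
Proof.
rewrite /vge emb_eq0; have [//|an] := eqVneq a 0.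
by rewrite /emb /= w_iota ?tofrac_eq0 // padic_val_ge0.
Qed.

Lemma emb_vge1 a : a \in p -> vge w 1 (emb a).
Proof.
rewrite /vge emb_eq0; have [//|an ap] := eqVneq a 0.
by rewrite /emb /= w_iota ?tofrac_eq0 // padic_val_in.
Qed.

Lemma emb_unit a : a \notin p -> w (emb a) = 0 /\ emb a != 0.
Proof.
move=> ap; have an : a != 0 by apply: contraNneq ap => ->; exact: (idealr0 (p : idealr A)).
by rewrite emb_eq0 /emb /= w_iota ?tofrac_eq0 // padic_val_notin.
Qed.

Lemma emb_uniformizer : exists2 a, a \in p & emb a != 0 /\ w (emb a) = 1.
Proof.
have [a ap [an va]] := padic_val_uniformizer hA hp; exists a => //.
by rewrite emb_eq0 /emb /= w_iota ?tofrac_eq0.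
Qed.

(** c is close to some u/a in K with a outside p. If a b = 1 - q with q in p, then
a has the approximate inverse b (1 + q + ... + q^(N-1)), with error q^N. *)
Lemma density N c : vge w 0 c -> exists a, vge w N (c - emb a).
Proof.
move=> hc; wlog N0 : N / 0 <= N.
  move=> h; have [a ha] := h (Num.max 0 N) (ltac:(by rewrite le_max lexx)).
  by exists a; apply: vge_le ha; rewrite le_max lexx orbT.
case: N N0 => // N _.
have [_ _ dense _] := hE; have [y /nearP hy] := dense c N%:Z.
have y0 : vge w 0 (iota y).
  rewrite -[iota y](subKr c); apply: vgeB => //.
  exact: vge_le hy.
have [y00|yn] := eqVneq y 0.
  by exists 0; move: hy; rewrite y00 /emb /= tofrac0.
move: y0; rewrite /vge fmorph_eq0 (negPf yn) w_iota //= => /(padic_val_ge0P hA yn)[a [u [ap ey]]].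
have [b hb] := maximal_inverse (prime_maximal hA hp) ap.
pose q := 1 - a * b; pose r := \sum_(i < N) q ^+ i.
exists (u * b * r).
have [wa an] := emb_unit ap.
have er : a * b * r = 1 - q ^+ N.
  have -> : a * b = - (q - 1) by rewrite opprB /q subKr.
  by rewrite mulNr -subrX1 opprB.
rewrite -(subrK (iota y) c) -addrA; apply: vgeD => //.
have -> : iota y - emb (u * b * r) = iota y * emb (q ^+ N).
  have -> : iota y = emb u / emb a by rewrite ey /emb fmorph_div.
  have -> : emb (u * b * r) = emb u / emb a * emb (a * b * r).
    by rewrite !rmorphM !mulrA divfK.
  by rewrite er rmorphB rmorph1 mulrBr mulr1 subKr.
rewrite -[N%:Z]add0r; apply: vgeM => //.
  by rewrite -[iota y](subKr c); apply: vgeB => //; apply: vge_le hy.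
by rewrite rmorphXn; apply: vgeX => //; apply: emb_vge1.
Qed.

End Embedding.

(** * Degrees, and radicals of algebras over a field *)

Section DegreeUnique.
Variables (E : fieldType) (S : comNzRingType) (psi : {rmorphism E -> S}).

Lemma has_degree_coord n (b : 'I_n -> S) :
  (forall x, exists! c : {ffun 'I_n -> E}, x = \sum_i psi (c i) * b i) ->
  forall c c' : 'I_n -> E, \sum_i psi (c i) * b i = \sum_i psi (c' i) * b i -> c =1 c'.
Proof.
move=> hb c c' e i; have [d [_ du]] := hb (\sum_i psi (c i) * b i).
have e1 : d = [ffun i => c i].
  by apply: du; apply: eq_bigr => j _; rewrite ffunE.
have e2 : d = [ffun i => c' i].
  by apply: du; rewrite e; apply: eq_bigr => j _; rewrite ffunE.
by have := congr1 (fun f : {ffun _} => f i) (etrans (esym e1) e2); rewrite !ffunE.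
Qed.

(** The base change matrices P and Q satisfy P Q = 1, which bounds m by n over a field. *)
Lemma has_degree_le m n : has_degree psi m -> has_degree psi n -> (m <= n)%N.
Proof.
move=> [b hb] [d hd].
have /choice[P hP] : forall i, exists c : 'I_n -> E, b i = \sum_j psi (c j) * d j.
  by move=> i; have [c [-> _]] := hd (b i); exists c.
have /choice[Q hQ] : forall j, exists c : 'I_m -> E, d j = \sum_i psi (c i) * b i.
  by move=> j; have [c [-> _]] := hb (d j); exists c.
apply: (@mulmx1_min E m n (\matrix_(i, j) P i j) (\matrix_(j, i) Q j i)).
apply/matrixP => i k; rewrite !mxE.
pose f k := \sum_j P i j * Q j k.
have: f =1 (fun k => (i == k)%:R).
  apply: (has_degree_coord hb).
  transitivity (b i).
    rewrite [RHS]hP; under [RHS]eq_bigr do rewrite hQ mulr_sumr.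
    rewrite exchange_big /=; apply: eq_bigr => l _; rewrite /f rmorph_sum mulr_suml.
    by apply: eq_bigr => j _; rewrite rmorphM mulrA.
  rewrite (bigD1 i) //= eqxx rmorph1 mul1r big1 ?addr0 // => l.
  by rewrite eq_sym => /negPf->; rewrite rmorph0 mul0r.
by move=> /(_ k) <-; apply: eq_bigr => j _; rewrite !mxE.
Qed.

Lemma degreeE n : has_degree psi n -> degree psi = n.
Proof.
move=> hn; rewrite /degree; case: xgetP => [m _ hm|/(_ n)//].
by apply/eqP; rewrite eqn_leq !has_degree_le.
Qed.

End DegreeUnique.

Section Nilpotent.
Variables (E : fieldType) (T : comAlgType E).

Lemma jacobson_unit (x y : T) : x \in @jacobson_radical T -> exists z, (1 + x * y) * z = 1.
Proof.
move=> /asboolP Jx; apply: contrapT => h.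
have [|P Pmax sub] := exists_maximal (principal_ideal (1 + x * y)).
  by move=> [z _ ez]; apply: h; exists z.
have := @prime_not1 _ P; apply.
rewrite -(addrK (x * y) 1); apply: is_idealB; first exact: is_ideal_prime.
  exact/sub/principal_self.
by apply: is_idealMr; [apply: is_ideal_prime|apply: (Jx P)].
Qed.

(** Let x be a root of X^k q with q(0) nonzero. Since x is in the radical, q(x) is
q(0) times a unit, hence x^k = 0. *)
Lemma jacobson_nilpotent (x : T) : x \in @jacobson_radical T ->
  integralOver (in_alg T) x -> exists k, x ^+ k = 0.
Proof.
move=> Jx [g gmon gx]; have [k [q q0 eg]] := multiplicity_XsubC g 0.
rewrite monic_neq0 //= in q0.
have [q1 eq1] : exists q1, q = q1 * 'X + q.[0]%:P.
  have /factor_theorem[q1 e] : root (q - q.[0]%:P) 0 by rewrite /root !hornerE subrr.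
  by exists q1; move: e; rewrite subr0 => <-; rewrite subrK.
have q00 : q.[0] != 0 by [].
pose y := (map_poly (in_alg T) q1).[x].
have eqx : (map_poly (in_alg T) q).[x] = y * x + q.[0]%:A.
  by rewrite {1}eq1 rmorphD rmorphM /= map_polyX map_polyC !hornerE.
have [z ez] := jacobson_unit (q.[0]^-1 *: y) Jx.
exists k; move: gx; rewrite /root eg subr0 rmorphM rmorphXn /= map_polyX !hornerE eqx => /eqP e.
rewrite -[x ^+ k]mul1r -ez.
have -> : 1 + x * (q.[0]^-1 *: y) = q.[0]^-1 *: (y * x + q.[0]%:A).
  by rewrite scalerDr scalerA mulVf // scale1r addrC mulrC scalerAl.
by rewrite mulrAC -scalerAl e scaler0 mul0r.
Qed.

End Nilpotent.

(** * The lattices spanned by B in the tensor product *)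

Section ClearDenominators.
Variables (A : idomainType) (L : fieldExtType {fraction A}).
Local Notation B := (integral_closure L).

Lemma clear_denominators m (q : 'I_m -> {fraction A}) :
  exists2 d, d != 0 & exists c : 'I_m -> A, forall i, tofrac d * q i = tofrac (c i).
Proof.
pose e i := \d_(repr (q i)).
exists (\prod_i e i); first by apply/prodf_neq0 => i _; apply: denom_ratioP.
exists (fun i => (\prod_(j | j != i) e j) * \n_(repr (q i))) => i.
by rewrite (bigD1 i) //= [e i * _]mulrC !tofracM -mulrA (mulrC _ (q i)) fraction_repr.
Qed.

(** If d clears the denominators of the minimal polynomial of x, then d x is a root
of a monic polynomial over A. *)
Lemma scale_integral (x : L) : exists2 d : A, d != 0 & exists b : B, val b = tofrac d *: x.
Proof.
have [f [fmon fx]] : exists f : {poly {fraction A}}, f \is monic /\ root (map_poly (in_alg L) f) x.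
  have /polyOver1P[g gK] := minPolyOver 1%AS x.
  exists g; rewrite -gK root_minPoly -(map_monic (in_alg L)) -gK monic_minPoly //.
pose m := (size f).-1.
have [d dn [c hc]] := clear_denominators (fun i : 'I_m => f`_i).
exists d => //; apply: integral_closureP.
(* With f of degree m, this is d^m f(X/d), whose coefficient of X^i is
   d^(m-i) f_i = d^(m-i-1) (d f_i). *)
pose g : {poly A} := 'X^m + \poly_(i < m) (if insub i is Some j then d ^+ (m - i.+1) * c j else 0).
have gmon : g \is monic.
  by rewrite monicE /g lead_coefDl ?size_polyXn ?ltnS ?size_poly // lead_coefXn.
exists g => //; rewrite /root /g rmorphD /= map_polyXn !hornerE.
have fE : (map_poly (in_alg L) f).[x] = x ^+ m + \sum_(i < m) f`_i *: x ^+ i.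
  rewrite horner_coef size_map_poly -/m polySpred ?monic_neq0 // -/m big_ord_recr /= addrC.
  rewrite coef_map /= -lead_coefE (monicP fmon) scale1r mul1r; congr (_ + _).
  by apply: eq_bigr => i _; rewrite coef_map /= -scalerAl mul1r.
have -> : (map_poly (@to_ext A L) (\poly_(i < m) (if insub i is Some j then d ^+ (m - i.+1) * c j else 0))).[tofrac d *: x]
   = tofrac d ^+ m *: \sum_(i < m) f`_i *: x ^+ i.
  rewrite (@horner_coef_wide _ m) ?size_map_poly ?(leq_trans (size_poly_le _)) ?size_poly //.
    rewrite scaler_sumr; apply: eq_bigr => i _.
    rewrite coef_map coef_poly ltn_ord valK /= /to_ext /= -scalerAl mul1r.
    rewrite exprZn !scalerA; congr (_ *: _).
    have -> : tofrac d ^+ m = tofrac d ^+ (m - i.+1) * (tofrac d ^+ i * tofrac d).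
      by rewrite -exprSr -exprD subnK.
    rewrite tofracM -hc tofracXn -!mulrA.
    by congr (_ * _); rewrite mulrA [RHS]mulrC.
  by apply: leq_trans (size_poly _ _) _; rewrite size_poly.
by rewrite exprZn -scalerDr -fE (rootP fx) scaler0.
Qed.

End ClearDenominators.

Lemma integral_rootX (R K : comNzRingType) (f : {rmorphism R -> K}) (x : K) k (b : R) :
  f b = x ^+ k.+1 -> integralOver f x.
Proof.
move=> eb; exists ('X^(k.+1) - b%:P).
  by rewrite monicE lead_coefDl ?lead_coefXn // size_polyN size_polyXn size_polyC; case: (b != 0).
by rewrite /root rmorphB rmorphXn /= map_polyX map_polyC !hornerE /= eb subrr.
Qed.

Section TensorLattice.
Variables (A : idomainType) (hA : dedekind A) (L : fieldExtType {fraction A}).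
Local Notation B := (integral_closure L).
Variables (p : prime_ideal A) (hp : exists2 x, x \in p & x != 0).
Variables (E : fieldType) (iota : {rmorphism {fraction A} -> E}) (w : E -> int).
Hypothesis hE : is_completion (padic_val p) iota w.
Variables (T : comAlgType E) (t : L -> E -> T).
Hypothesis hT : is_tensor_product iota t.
Local Notation phi := (to_int L).
Local Notation pB := (extension phi (carrier p)).
Local Notation emb := (emb iota).

Let hw := completion_valuation hE.

Lemma tensorDl x x' y : t (x + x') y = t x y + t x' y. Proof. by have [[h _ _] _ _ _ _] := hT. Qed.
Lemma tensorDr x y y' : t x (y + y') = t x y + t x y'. Proof. by have [[_ h _] _ _ _ _] := hT. Qed.
Lemma tensorZ a x y : t (a *: x) y = t x (iota a * y). Proof. by have [[_ _ h] _ _ _ _] := hT. Qed.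
Lemma tensorM x x' y y' : t (x * x') (y * y') = t x y * t x' y'. Proof. by have [_ _ _ h _] := hT. Qed.
Lemma tensor11 : t 1 1 = 1. Proof. by have [_ _ h _ _] := hT. Qed.
Lemma tensorE a x y : a *: t x y = t x (a * y). Proof. by have [_ _ _ _ h] := hT. Qed.
Lemma tensorx0 x : t x 0 = 0. Proof. by apply: (addrI (t x 0)); rewrite -tensorDr !addr0. Qed.
Lemma tensor0y y : t 0 y = 0. Proof. by apply: (addrI (t 0 y)); rewrite -tensorDl !addr0. Qed.
Lemma tensorNr x y : t x (- y) = - t x y.
Proof. by apply: (addrI (t x y)); rewrite -tensorDr !subrr tensorx0. Qed.
Lemma tensorNl x y : t (- x) y = - t x y.
Proof. by apply: (addrI (t x y)); rewrite -tensorDl !subrr tensor0y. Qed.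
Lemma tensor_suml (I : Type) (r : seq I) (P : pred I) (F : I -> L) y :
  t (\sum_(i <- r | P i) F i) y = \sum_(i <- r | P i) t (F i) y.
Proof. by apply: (big_morph (t^~ y) (fun x x' => tensorDl x x' y)); apply: tensor0y. Qed.
Lemma tensor_scale x y : t x y = y *: t x 1. Proof. by rewrite tensorE mulr1. Qed.

Local Notation n := (\dim {:L}).
Local Notation beta i := ((vbasis {:L})`_i).
Local Notation crd i := (coord (vbasis {:L}) i).

(** The coordinates of L over K extend to coordinates of T over E by the universal
property. *)
Lemma tensor_coord : exists h : 'I_n -> T -> E,
  (forall i, {morph h i : z z' / z + z'}) /\ forall i x y, h i (t x y) = iota (crd i x) * y.
Proof.
suff /choice[h hh] : forall i, exists hi : T -> E,
    {morph hi : z z' / z + z'} /\ forall x y, hi (t x y) = iota (crd i x) * y.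
  by exists h; split=> i; case: (hh i).
move=> i; have bal : balanced iota (fun x y => iota (crd i x) * y).
  split=> [x x' y|x y y'|a x y]; first by rewrite linearD rmorphD mulrDl.
    by rewrite mulrDr.
  by rewrite linearZ /= rmorphM [RHS]mulrCA mulrA.
have [_ univ _ _ _] := hT; have [h [hh _]] := univ _ _ bal.
by exists h; split=> // z z'; rewrite raddfD.
Qed.

(** The identity of T and the expansion along the coordinates agree on pure tensors,
so they are equal by uniqueness in the universal property. *)
Lemma tensor_span (z : T) : exists c : 'I_n -> E, z = \sum_(i < n) t (beta i) (c i).
Proof.
have [h [hD ht]] := tensor_coord.
pose g (z : T) := \sum_(i < n) t (beta i) (h i z).
have gD : {morph g : z z' / z + z'}.
  by move=> u u'; rewrite /g -big_split /=; apply: eq_bigr => i _; rewrite hD tensorDr.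
have gB : zmod_morphism g.
  by move=> u u'; apply: (addIr (g u')); rewrite -gD !subrK.
pose gA := GRing.isZmodMorphism.Build T T g gB.
pose g' : {additive T -> T} := HB.pack g gA.
have [[b1 b2 b3] univ _ _ _] := hT.
have [h0 [_ h0u]] := univ T t (And3 b1 b2 b3).
have gt x y : g' (t x y) = t x y.
  rewrite /= /g {2}(coord_vbasis (memvf x)) tensor_suml; apply: eq_bigr => i _.
  by rewrite ht tensorZ.
have e1 := h0u idfun (fun x y => erefl); have e2 := h0u g' gt.
exists (fun i => h i z).
exact: (congr1 (fun f : {additive T -> T} => f z) (etrans (esym e1) e2)).
Qed.

(** This is pi^N M, where M is spanned by the image of B over the valuation ring. *)
Definition lat (N : int) : set T := [set z |
  exists m (b : 'I_m -> B) (c : 'I_m -> E),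
    (forall i, vge w N (c i)) /\ z = \sum_i t (val (b i)) (c i)].

Lemma lat_t N b c : vge w N c -> lat N (t (val (b : B)) c).
Proof. by move=> hc; exists 1%N, (fun=> b), (fun=> c); rewrite big_ord1. Qed.

Lemma lat0 N : lat N 0.
Proof. by exists 0%N, (fun=> 0), (fun=> 0); split=> [[]|] //; rewrite big_ord0. Qed.

Lemma latD N z z' : lat N z -> lat N z' -> lat N (z + z').
Proof.
move=> [m [b [c [hc ->]]]] [m' [b' [c' [hc' ->]]]].
exists (m + m')%N, (cat_fam b b'), (cat_fam c c'); split=> [i|].
  by rewrite /cat_fam; case: fintype.splitP.
have [bl br] := cat_famP b b'; have [cl cr] := cat_famP c c'.
by rewrite big_split_ord; congr (_ + _); apply: eq_bigr => i _; rewrite ?bl ?br ?cl ?cr.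
Qed.

Lemma lat_sum N (I : Type) (r : seq I) (P : pred I) (F : I -> T) :
  (forall i, P i -> lat N (F i)) -> lat N (\sum_(i <- r | P i) F i).
Proof. by move=> h; elim/big_ind: _ => //; [apply: lat0|apply: latD]. Qed.

Lemma latN N z : lat N z -> lat N (- z).
Proof.
move=> [m [b [c [hc ->]]]]; rewrite -sumrN; apply: lat_sum => i _.
by rewrite -tensorNr; apply: lat_t; apply: vgeN.
Qed.

Lemma latB N z z' : lat N z -> lat N z' -> lat N (z - z').
Proof. by move=> hz /latN; apply: latD. Qed.

Lemma latM M N z z' : lat M z -> lat N z' -> lat (M + N) (z * z').
Proof.
move=> [m [b [c [hc ->]]]] [m' [b' [c' [hc' ->]]]].
rewrite mulr_suml; apply: lat_sum => i _; rewrite mulr_sumr; apply: lat_sum => j _.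
rewrite -tensorM; have -> : val (b i) * val (b' j) = val (b i * b' j) by rewrite rmorphM.
by apply: lat_t; apply: vgeM.
Qed.

Lemma latZ M N a z : vge w M a -> lat N z -> lat (M + N) (a *: z).
Proof.
move=> ha [m [b [c [hc ->]]]]; rewrite scaler_sumr; apply: lat_sum => i _.
by rewrite tensorE; apply: lat_t; apply: vgeM.
Qed.

Lemma lat_le M N z : M <= N -> lat N z -> lat M z.
Proof.
move=> MN [m [b [c [hc ->]]]]; apply: lat_sum => i _; apply: lat_t.
exact: vge_le (hc i).
Qed.

Lemma lat_span z : exists N, lat N z.
Proof.
have [c ->] := tensor_span z.
have /choice[e he] : forall i : 'I_n, exists e : A * B,
    e.1 != 0 /\ val e.2 = tofrac e.1 *: beta i.
  by move=> i; have [d dn [b hb]] := scale_integral (beta i); exists (d, b).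
have ht (i : 'I_n) : t (beta i) (c i) = t (val (e i).2) (c i / emb (e i).1).
  have [dn ->] := he i; rewrite tensorZ mulrCA mulfV ?mulr1 //.
  by rewrite (emb_eq0 iota).
pose N i := w (c i / emb (e i).1).
have [M hM] : exists M, forall i, M <= N i.
  exists (- \sum_i `|N i|) => i; rewrite lerNl (bigD1 i) //=.
  by apply: (le_trans (ler_norm _)); rewrite normrN lerDl sumr_ge0.
exists M; apply: lat_sum => i _; rewrite ht; apply: lat_t.
exact: vge_le (hM i) (vge_w _ _).
Qed.

(** The coefficients can be approximated by elements of A, so B is dense in M. *)
Lemma lat_approx z N : lat 0 z -> exists b : B, lat N (z - t (val b) 1).
Proof.
move=> [m [b [c [hc ->]]]].
have /choice[a ha] := fun i => density hA hp hE N (hc i).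
exists (lincomb phi b a); rewrite val_lincomb tensor_suml -sumrB; apply: lat_sum => i _.
by rewrite tensorZ mulr1 -tensorNr -tensorDr; apply/lat_t/ha.
Qed.

Lemma lat_pB N x : lat N x -> forall b, pB b -> lat (1 + N) (t (val b) 1 * x).
Proof.
move=> hx b; suff sub : pB `<=` [set b | lat (1 + N) (t (val b) 1 * x)] by exact: sub.
apply: ideal_gen_min => [|_ [a ap <-]].
  split=> [|c y z] /=; first by rewrite tensor0y mul0r; apply: lat0.
  move=> hy hz; rewrite -[X in lat _ X]/(t (val c * val y + val z) 1 * x) tensorDl mulrDl; apply: latD => //.
  rewrite -[X in t (_ * _) X]mulr1 tensorM -mulrA -[1 + N]add0r; apply: latM => //.
  by apply: lat_t; apply: vge1.
rewrite /= /to_ext /= tensorZ mulr1 tensor_scale tensor11 -scalerAl mul1r; apply: latZ => //.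
exact: (emb_vge1 hA hE ap).
Qed.

(** Write theta(x) as a combination of b_i with coefficients c_i, and approximate the
c_i by a_i in A. The coordinates of x - sum a_i b_i along a K-basis of L taken
in B are combinations of the small errors with fixed coefficients, so they are
p-integral, and a denominator prime to p brings this difference into B. *)
Lemma purity x : lat 0 (t x 1) -> exists2 a, a \notin p & exists b : B, val b = tofrac a *: x.
Proof.
move=> [m [b [c [hc ex]]]]; have [h [hD ht]] := tensor_coord.
have h0 j : h j 0 = 0 by apply: (addrI (h j 0)); rewrite -hD !addr0.
have hsum j (I : Type) (r : seq I) (F : I -> T) : h j (\sum_(i <- r) F i) = \sum_(i <- r) h j (F i).
  exact: (big_morph (h j) (hD j) (h0 j)).
have hN j z : h j (- z) = - h j z by apply: (addrI (h j z)); rewrite -hD !subrr h0.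
have /choice[e he] : forall i : 'I_n, exists e : A * B,
    e.1 != 0 /\ val e.2 = tofrac e.1 *: beta i.
  by move=> i; have [d dn [y hy]] := scale_integral (beta i); exists (d, y).
pose C (j : 'I_n) (i : 'I_m) := iota (crd j (val (b i))) / emb (e j).1.
(* N bounds the loss of precision caused by the coefficients C j i. *)
pose N := \sum_j \sum_i `|w (C j i)|.
have CN j i : vge w (- N) (C j i).
  apply: vge_le (vge_w _ _); rewrite lerNl /N (bigD1 j) //= (bigD1 i) //=.
  apply: (le_trans (ler_norm _)); rewrite normrN -addrA lerDl addr_ge0 ?sumr_ge0 // => k _.
  by rewrite sumr_ge0.
have /choice[a ha] := fun i => density hA hp hE N (hc i).
pose s := lincomb phi b a; pose x' := x - val s.
have ex' : t x' 1 = \sum_i t (val (b i)) (c i - emb (a i)).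
  rewrite /x' tensorDl tensorNl ex val_lincomb tensor_suml -sumrB; apply: eq_bigr => i _.
  by rewrite tensorZ mulr1 tensorDr tensorNr.
have crdx' j : iota (crd j x') / emb (e j).1 = \sum_i C j i * (c i - emb (a i)).
  have := congr1 (h j) ex'; rewrite ht mulr1 hsum => ->; rewrite mulr_suml.
  by apply: eq_bigr => i _; rewrite ht mulrAC.
pose q j := crd j x' / tofrac (e j).1.
have hq j : q j != 0 -> 0 <= padic_val p (q j).
  move=> qn; have : vge w 0 (iota (q j)).
    rewrite /q fmorph_div -/(emb _) crdx'; apply: vge_sum => // i _.
    by rewrite -(addNr N); apply: vgeM.
  by rewrite /vge fmorph_eq0 (negPf qn) (w_iota hE).
have [d dp [u hu]] := common_denominator hA hq.
exists d => //; exists (to_int L d * s + lincomb phi (fun j => (e j).2) u).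
set r := lincomb _ _ _.
have -> : val (to_int L d * s + r) = @to_ext A L d * val s + val r by rewrite rmorphD rmorphM.
rewrite (val_lincomb _ u) {1}/to_ext /= -scalerAl mul1r.
rewrite -[in RHS](subrK (val s) x) scalerDr addrC; congr (_ + _).
rewrite -/x' [in RHS](coord_vbasis (memvf x')) scaler_sumr; apply: eq_bigr => j _.
have [en ->] := he j; rewrite !scalerA -hu /q -mulrA divfK // tofrac_eq0 //.
Qed.

(** With [purity] applied to b/pi, some a outside p maps b into pB; a is invertible
modulo p, so b is in pB. *)
Lemma lat1_pB (b : B) : lat 1 (t (val b) 1) -> pB b.
Proof.
move=> hb; have [u up [un wu]] := emb_uniformizer hA hp hE.
have un' : tofrac u != 0 by move: un; rewrite (emb_eq0 iota) tofrac_eq0.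
have [|a ap [s hs]] := @purity ((tofrac u)^-1 *: val b).
  rewrite tensorZ mulr1 fmorphV tensor_scale -[0]/(- 1 + 1 : int); apply: latZ => //.
  by rewrite /vge (valuationV hw un) wu orbT.
have e : phi a * b = phi u * s.
  apply: val_inj; rewrite !rmorphM /= hs /to_ext /= -!scalerAl !mul1r !scalerA.
  by congr (_ *: _); rewrite [RHS]mulrAC mulfV // mul1r.
have [a' ha'] := maximal_inverse (prime_maximal hA hp) ap.
have -> : b = phi (1 - a * a') * b + phi a' * (phi u * s).
  by rewrite -e rmorphB rmorph1 rmorphM mulrBl mul1r mulrA (mulrC (phi a')) subrK.
have hpB := extension_ideal phi (carrier p).
apply: is_idealD => //; first exact: pB_mul.
by apply: is_idealM => //; apply: pB_mul.
Qed.

(** An E-subspace of T, the largest one inside M: its elements are divisible by every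
power of pi in M. *)
Definition divisible : set T := [set z | forall N, lat N z].

Lemma divisible_ideal : is_ideal divisible.
Proof.
split=> [N|a x y hx hy N]; first exact: lat0.
apply: latD => //; have [M hM] := lat_span a.
by rewrite -(subrKC M N); apply: latM.
Qed.

Lemma divisibleZ c z : divisible z -> divisible (c *: z).
Proof.
by move=> hz; rewrite -mulr_algl; exact: (is_idealM _ divisible_ideal hz).
Qed.

(** * The Jacobson radical of the tensor product *)

Local Notation V := (valuation_integer hw).

Definition vint_to_alg : V -> T := in_alg T \o val.
HB.instance Definition _ := GRing.RMorphism.on vint_to_alg.

Definition emb_int (a : A) : V :=
  ValuationInteger (emb_vge0 hA hE a : emb a \in in_valuation_ring hw).

Lemma emb_int_zmod_morphism : zmod_morphism emb_int.
Proof. by move=> a b; apply: val_inj; rewrite /= rmorphB. Qed.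
Lemma emb_int_monoid_morphism : monoid_morphism emb_int.
Proof. by split=> [|a b]; apply: val_inj; rewrite /= ?rmorph1 ?rmorphM. Qed.
HB.instance Definition _ := GRing.isZmodMorphism.Build A V emb_int emb_int_zmod_morphism.
HB.instance Definition _ := GRing.isMonoidMorphism.Build A V emb_int emb_int_monoid_morphism.

Definition inl_tensor (x : L) : T := t x 1.

Lemma inl_tensor_zmod_morphism : zmod_morphism inl_tensor.
Proof. by move=> x y; rewrite /inl_tensor tensorDl tensorNl. Qed.
Lemma inl_tensor_monoid_morphism : monoid_morphism inl_tensor.
Proof. by split=> [|x y]; rewrite /inl_tensor ?tensor11 // -tensorM mulr1. Qed.
HB.instance Definition _ := GRing.isZmodMorphism.Build L T inl_tensor inl_tensor_zmod_morphism.
HB.instance Definition _ := GRing.isMonoidMorphism.Build L T inl_tensor inl_tensor_monoid_morphism.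

(** The elements of B are integral over A, and scalars of the valuation ring are
integral over it. *)
Lemma lat_integral z : lat 0 z -> integralOver vint_to_alg z.
Proof.
move=> [m [b [c [hc ->]]]]; elim/big_ind: _ => [|x y hx hy|i _].
- exact: integral0.
- exact: integral_add.
have -> : t (val (b i)) (c i) = vint_to_alg (ValuationInteger (hc i : c i \in in_valuation_ring hw)) * inl_tensor (val (b i)).
  by rewrite /vint_to_alg /= -scalerAl mul1r -tensor_scale.
apply: integral_mul; first exact: integral_id.
have [f fmon fx] := integral_rmorph inl_tensor (val_integral (b i)).
exists (map_poly emb_int f); first by rewrite monic_map.
rewrite -map_poly_comp; congr (root _ _): fx; apply: eq_map_poly => a /=.
by rewrite /inl_tensor /to_ext /= tensorZ mulr1 tensor_scale tensor11.
Qed.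

(** If d in D is not in the maximal ideal m, some multiple d y in D is congruent to 1
modulo m. Then d y/pi is in D, hence integral, and its equation holds for 1/pi
modulo m, hence in E. But 1/pi is not integral over the valuation ring. *)
Lemma divisible_jacobson : divisible `<=` carrier (@jacobson_radical T).
Proof.
move=> d Dd; apply/asboolP => m mmax; apply: contrapT => /negP dm.
have [y hy] := maximal_inverse mmax dm.
have [u up [un wu]] := emb_uniformizer hA hp hE.
set e := emb u in un wu.
have De : divisible (e^-1 *: (d * y)) by apply: divisibleZ; apply: (is_idealMr _ divisible_ideal Dd).
have [f fmon fx] := lat_integral (De 0).
pose F := map_poly val f : {poly E}.
have fE : map_poly vint_to_alg f = map_poly (in_alg T) F by rewrite -map_poly_comp.
have Fm : (map_poly (in_alg T) F).[e^-1%:A] \in m.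
  have em : \pi_({ideal_quot m}) (e^-1 *: (d * y)) = \pi_({ideal_quot m}) (e^-1%:A).
    apply/eqP; rewrite eq_sym -Quotient.idealrBE -scalerBr -mulr_algl.
    exact: idealMr.
  rewrite -pi_eq0 -(horner_map \pi_({ideal_quot m})) /= -em horner_map /= -fE.
  by rewrite (rootP fx) rmorph0.
(* A scalar in m is zero, since a nonzero one is a unit. *)
have root_F : F.[e^-1] = 0.
  apply: contrapT => /eqP Fn; move: Fm; rewrite horner_map => Fm.
  have: F.[e^-1]^-1%:A * (F.[e^-1])%:A \in m by apply: idealMr.
  by rewrite -scalerAl mul1r scalerA mulVf // scale1r idealr1.
have Fmon : F \is monic by apply: monic_map.
pose k := (size F).-1.
have := not_vge1 hw; apply/negP/negPn.
have sF : size F = k.+1 by rewrite /k polySpred ?monic_neq0.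
move: root_F; rewrite horner_coef sF big_ord_recr /=.
have -> : F`_k = 1 by rewrite -(monicP Fmon) lead_coefE.
rewrite mul1r => /eqP; rewrite addrC addr_eq0 => /eqP ek.
(* The equation of 1/pi, multiplied by pi^k, would make 1 divisible by pi. *)
have -> : 1 = - (e ^+ k * \sum_(i < k) F`_i * e^-1 ^+ i).
  by rewrite -mulrN -ek -exprMn mulfV // expr1n.
apply: vgeN => //; rewrite mulr_sumr; apply: vge_sum => // i _.
rewrite mulrCA -[1]add0r; apply: vgeM => //.
  by rewrite coef_map; apply: (vint_valP (f`_i)).
have -> : e ^+ k = e ^+ (k - i) * e ^+ i by rewrite -exprD subnK // ltnW.
rewrite exprVn mulfK ?expf_neq0 //.
apply: (vge_le _ (vgeX hw _ _)); first by rewrite lez_nat subn_gt0.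
by rewrite /vge wu lexx orbT.
Qed.

Lemma lat1 : lat 0 1.
Proof. by rewrite -tensor11 -[1](rmorph1 (val : {rmorphism B -> L})); apply: lat_t; apply: vge1. Qed.

Lemma latX z k : lat 0 z -> lat 0 (z ^+ k).
Proof.
move=> hz; elim: k => [|k IH]; first by rewrite expr0; apply: lat1.
by rewrite exprS -[0]addr0; apply: latM.
Qed.

Lemma scale_lat z : exists2 c, c != 0 & lat 0 (c *: z).
Proof.
have [u up [un wu]] := emb_uniformizer hA hp hE; have [M hM] := lat_span z.
exists (emb u ^+ `|M|%N); first by rewrite expf_neq0.
apply: (@lat_le 0 (`|M|%N%:Z + M)); last first.
  by apply: latZ => //; apply: vgeX => //; rewrite /vge wu lexx orbT.
by rewrite -lerBlDr sub0r abszE -normrN ler_norm.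
Qed.

Lemma unscale_divisible c z : c != 0 -> divisible (c *: z) -> divisible z.
Proof. by move=> cn /(@divisibleZ c^-1); rewrite scalerA mulVf // scale1r. Qed.

Lemma algebraic_over_completion (z : T) : integralOver (in_alg T) z.
Proof.
have [c cn hc] := scale_lat z; have [f fmon fx] := lat_integral hc.
have -> : z = in_alg T c^-1 * (c *: z).
  by rewrite /= -scalerAl mul1r scalerA mulVf // scale1r.
apply: integral_mul; first exact: integral_id.
exists (map_poly val f); first exact: monic_map.
by rewrite -map_poly_comp.
Qed.

(** Let x^(k+1) = 0 and approximate x by b in B to precision pi^((k+1) l). Then
b^(k+1) lies in pi^((k+1) l) M, so (b/pi^l)^(k+1) is integral at p by [purity],
and so is b/pi^l because B is integrally closed. Hence x lies in pi^l M. *)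
Lemma nilpotent_lat x k : lat 0 x -> x ^+ k = 0 -> divisible x.
Proof.
case: k => [|k] hx xk; first by have /eqP := xk; rewrite expr0 oner_eq0.
suff h (l : nat) : lat l%:Z x.
  by move=> N; apply: (lat_le _ (h `|N|%N)); rewrite abszE ler_norm.
have [u up [un wu]] := emb_uniformizer hA hp hE.
have un' : tofrac u != 0 by move: un; rewrite (emb_eq0 iota) tofrac_eq0.
have [b hb] := lat_approx (k.+1 * l)%N%:Z hx.
have lb : lat 0 (t (val b) 1) by apply: lat_t; apply: vge1.
have bk : lat (k.+1 * l)%N%:Z (t (val b) 1 ^+ k.+1).
  rewrite -[_ ^+ _](subKr (x ^+ k.+1)) {1}xk sub0r subrXX; apply: latN.
  rewrite -[X in lat X]addr0; apply: latM => //; apply: lat_sum => i _.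
  by rewrite -[0]addr0; apply: latM; apply: latX.
pose s := (tofrac u ^+ l)^-1 *: val b.
have [|a ap [b1 hb1]] := @purity (s ^+ k.+1).
  rewrite -/(inl_tensor _) rmorphXn /= /inl_tensor /s tensorZ mulr1 tensor_scale exprZn.
  rewrite -(addNr (k.+1 * l)%N%:Z); apply: latZ => //.
  rewrite fmorphV rmorphXn -/(emb u) exprVn -exprM (mulnC l).
  have ukn : emb u ^+ (k.+1 * l) != 0 by rewrite expf_neq0.
  rewrite /vge (valuationV hw ukn) lerN2; apply/orP; right.
  suff -> : w (emb u ^+ (k.+1 * l)) = (k.+1 * l)%N by [].
  elim: (k.+1 * l)%N => [|j IH]; first by rewrite expr0 (valuation1 hw).
  by rewrite exprS (valuationM hw) ?expf_neq0 // IH wu intS.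
have [b2 hb2] : exists b' : B, val b' = tofrac a *: s.
  apply: integral_over_closure.
  apply: (@integral_rootX _ _ _ _ k (to_int L (a ^+ k) * b1)).
  rewrite rmorphM /= hb1 /to_ext /= -scalerAl mul1r scalerA -tofracM -exprSr.
  by rewrite [RHS]exprZn tofracXn.
have an : tofrac a != 0.
  by rewrite tofrac_eq0; apply: contraNneq ap => ->; exact: (idealr0 (p : idealr A)).
have eb : val b = (tofrac u ^+ l / tofrac a) *: val b2.
  by rewrite hb2 /s !scalerA divfK // mulfV ?scale1r // expf_neq0.
rewrite -(subrK (t (val b) 1) x); apply: latD.
  by apply: (lat_le _ hb); rewrite lez_nat leq_pmull.
rewrite eb tensorZ mulr1; apply: lat_t; rewrite rmorphM rmorphXn fmorphV -/(emb u) -/(emb a).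
have [wa an'] := emb_unit hA hE ap.
rewrite -[l%:Z]addr0; apply: vgeM => //; first by apply: vgeX => //; rewrite /vge wu lexx orbT.
by rewrite /vge (valuationV hw an') wa oppr0 lexx orbT.
Qed.

Lemma jacobson_divisible : carrier (@jacobson_radical T) `<=` divisible.
Proof.
move=> x Jx; have [k xk] := jacobson_nilpotent Jx (algebraic_over_completion x).
have [c cn hc] := scale_lat x; apply: (unscale_divisible cn).
by apply: (@nilpotent_lat _ k) => //; rewrite exprZn xk scaler0.
Qed.

(** * A basis of the semisimplification over the completion *)

Section Basis.
Variables (r : nat) (b : 'I_r -> B).
Hypothesis hb : rel_basis phi p pB setT b.
Local Notation tb i := (t (val (b i)) 1).

(** A relation is divided by a coefficient of least valuation. Its reduction modulo
pi is a relation over k between the b_i modulo pB, with a coefficient equal to 1. *)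
Lemma completion_independent (c : 'I_r -> E) :
  divisible (\sum_i c i *: tb i) -> forall i, c i = 0.
Proof.
move=> hc; apply: contrapT => nz.
have [i0 ci0 cmin] : exists2 i0, c i0 != 0 & forall i, c i != 0 -> w (c i0) <= w (c i).
  have [i1 ci1] : exists i, c i != 0.
    by apply: contrapT => h; apply: nz => i; apply/eqP/negPn/negP => ci; apply: h; exists i.
  by case: (@arg_minP _ _ _ i1 (fun i => c i != 0) (fun i => w (c i)) ci1) => i; exists i.
pose e i := c i / c i0.
have e0 i : vge w 0 (e i).
  rewrite /vge /e mulf_eq0 invr_eq0 (negPf ci0) orbF; have [//|ci /=] := eqVneq (c i) 0.
  by rewrite (valuationM hw) ?invr_eq0 // (valuationV hw) // subr_ge0 cmin.
have De : divisible (\sum_i e i *: tb i).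
  have -> : \sum_i e i *: tb i = (c i0)^-1 *: \sum_i c i *: tb i.
    by rewrite scaler_sumr; apply: eq_bigr => i _; rewrite scalerA mulrC.
  exact: divisibleZ.
have /choice[a ha] := fun i => density hA hp hE 1 (e0 i).
have ap : a i0 \in p.
  have [_ _ ind] := hb; apply: (ind a); apply: lat1_pB.
  rewrite val_lincomb tensor_suml.
  have -> : \sum_i t (tofrac (a i) *: val (b i)) 1 =
     \sum_i e i *: tb i - \sum_i (e i - emb (a i)) *: tb i.
    by rewrite -sumrB; apply: eq_bigr => i _; rewrite tensorZ mulr1 tensor_scale -scalerBl subKr.
  apply: latB; first exact: De.
  by apply: lat_sum => i _; rewrite -tensor_scale; apply: lat_t.
have := not_vge1 hw; apply/negP/negPn.
have -> : 1 = (e i0 - emb (a i0)) + emb (a i0) by rewrite subrK /e mulfV.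
by apply: vgeD => //; apply: (emb_vge1 hA hE ap).
Qed.

Lemma completion_step z u : lat 0 z -> emb u != 0 -> w (emb u) = 1 -> exists a : 'I_r -> A,
  lat 0 ((emb u)^-1 *: (z - \sum_i emb (a i) *: tb i)).
Proof.
move=> hz un wu; have [s hs] := lat_approx 1 hz.
have [_ span _] := hb; have [a ha] := span s I; exists a.
rewrite -[0]/(- 1 + 1 : int); apply: latZ => //.
  by rewrite /vge (valuationV hw un) wu lexx orbT.
rewrite -(subrK (t (val s) 1) z) -addrA; apply: latD => //.
have -> : t (val s) 1 - \sum_i emb (a i) *: tb i = t (val (s - lincomb phi b a)) 1 * 1.
  have -> : val (s - lincomb phi b a) = val s - val (lincomb phi b a) by rewrite rmorphB.
  rewrite mulr1 tensorDl tensorNl val_lincomb tensor_suml; congr (_ - _); apply: eq_bigr => i _.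
  by rewrite tensorZ mulr1 [RHS]tensor_scale.
by rewrite -[X in lat X]addr0; apply: (lat_pB lat1).
Qed.

(** Iterating [completion_step] expands z along the b_i with coefficients that are
partial sums of power series in pi; their limits give z modulo D. *)
Lemma completion_span_lat z : lat 0 z ->
  exists c : 'I_r -> E, divisible (z - \sum_i c i *: tb i).
Proof.
move=> hz; have [u up [un wu]] := emb_uniformizer hA hp hE; set e := emb u in un wu.
have /choice[F hF] : forall z, exists a : 'I_r -> A,
    lat 0 z -> lat 0 (e^-1 *: (z - \sum_i emb (a i) *: tb i)).
  move=> y; have [hy|ny] := pselect (lat 0 y); last by exists (fun=> 0).
  by have [a ha] := completion_step hy un wu; exists a.
pose next y := e^-1 *: (y - \sum_i emb (F y i) *: tb i).
pose y k := iter k next z.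
have hy k : lat 0 (y k) by elim: k => //= k IH; apply: hF.
pose c i k := \sum_(j < k) e ^+ j * emb (F (y j) i).
have ue1 : vge w 1 e by rewrite /vge wu lexx orbT.
have cS i k : c i k.+1 = c i k + e ^+ k * emb (F (y k) i) by rewrite /c big_ord_recr.
(* After k steps the remainder is pi^k times an element of M. *)
have expand k : z = \sum_i c i k *: tb i + e ^+ k *: y k.
  elim: k => [|k IH].
    by rewrite big1 ?add0r ?scale1r // => i _; rewrite /c big_ord0 scale0r.
  rewrite [LHS]IH /= /next scalerA exprSr mulfK // scalerBr.
  under [in RHS]eq_bigr do rewrite cS scalerDl -scalerA.
  by rewrite big_split /= -scaler_sumr -addrA addrC [RHS]addrC (addrC (_ *: _) (_ - _)) subrK.
have cauchy i m k : (m <= k)%N -> vge w m%:Z (c i k - c i m).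
  move=> /subnK <-; elim: (k - m)%N => [|j IH]; first by rewrite add0n subrr vge0.
  rewrite addSn cS addrAC; apply: vgeD => //.
  rewrite -[m%:Z]addr0; apply: vgeM => //; last exact: (emb_vge0 hA hE).
  by apply: (vge_le _ (vgeX hw _ ue1)); rewrite lez_nat leq_addl.
have /choice[l hl] : forall i, exists l, forall N, exists m, forall k, (m <= k)%N -> near_for w N (c i k) l.
  move=> i; have [_ _ _ complete] := hE; apply: complete => N.
  exists `|N|%N => j k Nj Nk; apply/nearP.
  apply: (@vge_le _ _ N `|N|%N%:Z); first by rewrite abszE ler_norm.
  rewrite -(subrK (c i `|N|%N) (c i j)) -addrA; apply: vgeD => //; first exact: cauchy.
  by rewrite -opprB; apply: vgeN => //; apply: cauchy.
exists l => N; apply: (@lat_le N `|N|%N%:Z); first by rewrite abszE ler_norm.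
set m := `|N|%N.
have lc i : vge w m%:Z (c i m - l i).
  have [k hk] := hl i m%:Z; pose k' := maxn m k.
  rewrite -(subrK (c i k') (c i m)) -addrA; apply: vgeD => //.
    by rewrite -opprB; apply: vgeN => //; apply: cauchy; apply: leq_maxl.
  by apply/nearP/hk; apply: leq_maxr.
have -> : z - \sum_i l i *: tb i = \sum_i (c i m - l i) *: tb i + e ^+ m *: y m.
  rewrite {1}(expand m) addrAC -sumrB; congr (_ + _); apply: eq_bigr => i _.
  by rewrite scalerBl.
apply: latD; first by apply: lat_sum => i _; rewrite -tensor_scale; apply: lat_t.
by rewrite -[m%:Z]addr0; apply: latZ => //; apply: vgeX.
Qed.

Lemma completion_span z : exists c : 'I_r -> E, divisible (z - \sum_i c i *: tb i).
Proof.
have [d dn hd] := scale_lat z; have [c hc] := completion_span_lat hd.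
exists (fun i => d^-1 * c i); apply: (unscale_divisible dn).
rewrite scalerBr scaler_sumr.
by under eq_bigr do rewrite scalerA mulrA mulfV // mul1r.
Qed.

Lemma completion_has_degree : has_degree (@ss_map E T) r.
Proof.
pose J : idealr T := @jacobson_radical T.
pose pi (z : T) : semisimplification T := \pi_({ideal_quot J}) z.
have piE z z' : pi z = pi z' <-> divisible (z - z').
  split=> [e|D]; last by apply/eqP; rewrite -Quotient.idealrBE; apply: divisible_jacobson.
  by apply: jacobson_divisible; rewrite /carrier /= Quotient.idealrBE; apply/eqP.
have piS (c : 'I_r -> E) : pi (\sum_i c i *: tb i) = \sum_i @ss_map E T (c i) * pi (tb i).
  rewrite /pi rmorph_sum; apply: eq_bigr => i _.
  by rewrite /ss_map -rmorphM -scalerAl mul1r.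
exists (fun i => pi (tb i)) => x; have [c hc] := completion_span (repr x).
have ex : x = pi (repr x) by rewrite /pi reprK.
exists [ffun i => c i]; split.
  rewrite ex; under [RHS]eq_bigr do rewrite ffunE.
  by rewrite -piS; apply/piE.
move=> c' hc'; apply/ffunP => i; rewrite ffunE; apply/eqP; rewrite -subr_eq0; apply/eqP.
move: i; apply: completion_independent.
have -> : \sum_i (c i - c' i) *: tb i = \sum_i c i *: tb i - \sum_i c' i *: tb i.
  by rewrite -sumrB; apply: eq_bigr => i _; rewrite scalerBl.
by apply/piE; rewrite [RHS]piS -hc' ex; apply/esym/piE.
Qed.

End Basis.
End TensorLattice.

Theorem theorem1 (A : idomainType) (hA : dedekind A)
    (L : fieldExtType {fraction A})
    (p : prime_ideal A) (hp : exists2 x, x \in p & x != 0)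
    (Kp : fieldType) (iota : {rmorphism {fraction A} -> Kp}) (w : Kp -> int)
    (hKp : is_completion (padic_val p) iota w)
    (T : comAlgType Kp) (t : L -> Kp -> T)
    (hT : is_tensor_product iota t) :
  [/\ finite_set (primes_over L p),
      forall P, primes_over L p P -> finite_degree (residue_map p P),
      finite_degree (@ss_map Kp T)
    & \sum_(P \in primes_over L p)
        (ramification_index p P * residue_degree p P)%N
      = degree (@ss_map Kp T)].
Proof.
have [b hb] := sum_over hA L hp.
have hd := completion_has_degree hA hp hKp hT hb.
split.
- exact: primes_over_finite.
- by move=> P Pp; apply: residue_finite.
- by eexists; exact: hd.
pose psi : {rmorphism Kp -> semisimplification T} :=
  \pi_({ideal_quot (@jacobson_radical T : idealr T)}) \o in_alg T.
by apply/esym/(degreeE (psi := psi)).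
Qed.
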